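(* Let $R$ be a polarized proof-structure which is $\wp_{\mathsf o}$-terminal. The following are equivalent: (1) $R\models\mathsf{ACC}_{\sharp\mathsf w}$; (2) $R\models\mathsf{ACC}_{\mathsf i/\mathsf o}$; (3) $R$ is sequential.
   Context: Graphs. A graph $G$ consists of finite disjoint sets $N(G)$ (nodes), $A(G)$ (arcs) and functions $\mathrm{tail},\mathrm{head}:A(G)\to N(G)$ (loops and parallel arcs allowed). An arc $a$ is a conclusion of $\mathrm{tail}(a)$ and a premise of $\mathrm{head}(a)$; its ends are $\mathrm{tail}(a),\mathrm{head}(a)$. A path from $n_0$ to $n_k$ is an alternating sequence $n_0a_1n_1\dots a_kn_k$ ($k\ge 0$) of nodes and arcs such that the ends of $a_i$ are $n_{i-1}$ and $n_i$; $n_i=n_j$ with $i\ne j$ implies $\{i,j\}=\{0,k\}$; and $a_1\neq a_k$ if $k\ge2$. It is directed if $\mathrm{tail}(a_i)=n_{i-1}$ and $\mathrm{head}(a_i)=n_i$ for all $i$; it is a cycle if $k>0$ and $n_0=n_k$. $G$ is (directed) acyclic if it has no (directed) cycle. $\mathrm{cc}(G)$ is the set of (non-empty) connected components of $G$; $\sharp S$ is the cardinality of $S$. Ground-structures. Write $\wp$ for par. A ground-structure is a graph whose nodes carry labels in $\{\mathtt{ax},\mathtt{cut},\mathtt 1,\bot,\otimes,\wp,!,?\mathtt d,?,\bullet\}$ with the following numbers of premises and conclusions: $\mathtt{ax}$: 0 premises, 2 conclusions; $\mathtt{cut}$: 2, 0; $\mathtt 1$ and $\bot$: 0, 1; $\otimes$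 and $\wp$: 2, 1; $!$: 0 premises, at least 1 conclusion; $?\mathtt d$: 1, 1; $?$: any number $k\ge0$ of premises, 1 conclusion; $\bullet$: 1, 0. It is equipped with a total order on the set of premises of its $\bullet$ nodes (these arcs are the conclusions of the ground-structure), on the conclusions of each $!$ node, and on the premises of each $\otimes$ and $\wp$ node. The greatest conclusion of a $!$ node is its principal port, the others its auxiliary ports. A $?$ node with $0$ premises is a $?\mathtt w$ node; with at least $2$ premises a $?\mathtt c$ node. $\mathsf w(\mathcal G)$ is the set of $\bot$ and $?\mathtt w$ nodes of $\mathcal G$. Proof-structures. A proof-structure (of finite depth, inductively) is a pair $R=(\mathcal G_R,\mathrm{box}_R)$ where $\mathcal G_R$ is a ground-structure and $\mathrm{box}_R$ maps each $!$ node $n$ of $\mathcal G_R$ to a proof-structure $\mathrm{box}_R(n)$ (its box) whose ground-structure has as many conclusions as $n$, all the sets of nodes and arcs involved being pairwise disjoint. Write $R'\sqsubset R$ if $R'=\mathrm{box}_R(n)$ for some $!$ node $n$ of $\mathcal G_R$. $A(R)$ is the set of arcs of $R$, including those in boxes at all depths. Sequential proof-structures (induction on $\sharp A(R)$; the order of the conclusions is irrelevant). $R$ is $n$-sequential, for a node $n$ of $\mathcal G_R$, if there are sequential proof-structures $R_1,R_2$ (as needed) such that: $n$ is an $\mathtt{ax}$ (resp. $\mathtt 1$) node and $\mathcal G_R$ consists only of $n$, its conclusions and the $\bullet$ nodes below them; or $n$ is a $!$ node, $\mathcal G_R$ consists only of $n$, its conclusions and the $\bullet$ nodes below them, and $\mathrm{box}_R(n)=R_1$;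 or $n$ is a $\mathtt{cut}$ (resp. $\otimes$) node and $R$ is obtained from the disjoint union of $R_1$ and $R_2$ by making one conclusion of $R_1$ and one conclusion of $R_2$ the two premises of $n$ (removing the two $\bullet$ nodes), the conclusion of $n$, if any, being a conclusion of $R$; or $n$ is a $\bot$ (resp. $\wp$, $?\mathtt d$, $?$) node whose conclusion is a conclusion of $R$, and $R$ is obtained from $R_1$ by adding $n$ with $0$ (resp. two, one, $k\ge 0$) conclusions of $R_1$ as its premises (removing the corresponding $\bullet$ nodes). $R$ is sequential if it is $n$-sequential for some node $n$. The property $\mathsf{ACC}_{\sharp\mathsf w}$. A switching $\varphi$ of $\mathcal G$ maps each $\wp$ or $?\mathtt c$ node $n$ to one of its premises; $\mathcal G^\varphi$ is the graph obtained by erasing, for each $\wp$ or $?\mathtt c$ node $n$, every premise of $n$ except $\varphi(n)$. $\mathcal G\models\mathsf{ACC}_{\sharp\mathsf w}$ if for every switching $\varphi$ the graph $\mathcal G^\varphi$ is acyclic and $\sharp\mathrm{cc}(\mathcal G^\varphi)=\sharp\mathsf w(\mathcal G)+1$. Polarization. A ground-structure is polarized if its arcs are labelled $\mathsf i$ (input) or $\mathsf o$ (output) so that: $\mathtt{ax}$ nodes have one input and one output conclusion; $\mathtt{cut}$ nodes have one input and one output premise; conclusions of $\mathtt 1$ nodes are output, of $\bot$ nodes input; the principal port of a $!$ node is output, its auxiliary ports input; the conclusion of a $?\mathtt d$ node is input (its premise is arbitrary); premises and conclusion of a $?$ node are input; for $\otimes$: either both premises and the conclusion are output, or exactly one premise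 is input and the conclusion is input; for $\wp$: either both premises and the conclusion are input, or exactly one premise is input and the conclusion is output; premises of $\bullet$ nodes are arbitrary. A $?\mathtt d$ node is classical if its premise is output; a $\bullet$ node is output if its premise is output; $\mathsf d_{\mathsf c}(\mathcal G)$, $\mathsf o(\mathcal G)$ denote the sets of classical $?\mathtt d$ nodes and of output $\bullet$ nodes. A $\wp_{\mathsf o}$ node is a $\wp$ node with output conclusion. $\mathcal G$ is $\wp_{\mathsf o}$-terminal if the conclusion of every $\wp_{\mathsf o}$ node is a premise of a $\wp_{\mathsf o}$ node or of a $\bullet$ node. The graph $\mathcal G^{\mathsf i/\mathsf o}$ is obtained from $\mathcal G$ by erasing the input premise of every $\wp_{\mathsf o}$ node and reversing the orientation of every input arc. $\mathcal G\models\mathsf{ACC}_{\mathsf i/\mathsf o}$ if $\mathcal G^{\mathsf i/\mathsf o}$ is directed acyclic and $\sharp\mathsf d_{\mathsf c}(\mathcal G)+\sharp\mathsf o(\mathcal G)=1$. A proof-structure $R$ is polarized (resp. $\wp_{\mathsf o}$-terminal; satisfies $\mathsf{ACC}_{\sharp\mathsf w}$; satisfies $\mathsf{ACC}_{\mathsf i/\mathsf o}$) if $\mathcal G_R$ is (resp. is; does; does) and, inductively, so is (does) every $R'\sqsubset R$. *)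

(* Defs.v *)
From HB Require Import structures.
From mathcomp Require Import all_boot.

Set Implicit Arguments.
Unset Strict Implicit.
Unset Printing Implicit Defensive.

Record graph : Type := Graph {
  node : finType;
  arc : finType;
  tail : arc -> node;
  head : arc -> node }.

Arguments tail {g} a.
Arguments head {g} a.

Section Graphs.
Variable G : graph.
Implicit Types (x y n : node G) (a : arc G) (p : seq (arc G * node G)).

Definition premises n : {set arc G} := [set a | head a == n].
Definition conclusions n : {set arc G} := [set a | tail a == n].

Definition dstep a x y : bool := (tail a == x) && (head a == y).
Definition ustep a x y : bool := dstep a x y || dstep a y x.

(* The alternating sequence n_0 a_1 n_1 ... a_k n_k is represented by n_0
   together with the list [:: (a_1, n_1); ...; (a_k, n_k)]. *)
Fixpoint walk (step : arc G -> rel (node G)) x p : bool :=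
  if p is (a, y) :: p' then step a x y && walk step y p' else true.

Definition is_path (step : arc G -> rel (node G)) x p : Prop :=
  [/\ walk step x p,
      forall i j : nat, i < j -> j <= size p ->
        nth x (x :: unzip2 p) i = nth x (x :: unzip2 p) j ->
        i = 0 /\ j = size p
    & 1 < size p ->
        forall a, nth a (unzip1 p) 0 <> nth a (unzip1 p) (size p).-1].

Definition is_cycle (step : arc G -> rel (node G)) x p : Prop :=
  [/\ is_path step x p, 0 < size p & last x (unzip2 p) = x].

Definition acyclic : Prop := forall x p, ~ is_cycle ustep x p.
Definition dacyclic : Prop := forall x p, ~ is_cycle dstep x p.

Definition adjacent : rel (node G) := [rel x y | [exists a, ustep a x y]].

(* Every arc lies in the component of its ends, so that a component is
   determined by its set of nodes. *)
Definition cc : {set {set node G}} :=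
  equivalence_partition (connect adjacent) [set: node G].

End Graphs.

Definition erase (G : graph) (E : pred (arc G)) : graph :=
  @Graph (node G) {a : arc G | ~~ E a}
    (fun a => tail (val a)) (fun a => head (val a)).

Definition reverse (G : graph) (E : pred (arc G)) : graph :=
  @Graph (node G) (arc G)
    (fun a => if E a then head a else tail a)
    (fun a => if E a then tail a else head a).

(* [Der] is ?d, [Why] is ?, [Bullet] is the node below a conclusion. *)
Inductive label : Type :=
  Ax | Cut | One | Bot | Tens | Par | Bang | Der | Why | Bullet.

Lemma label_eq_dec (l1 l2 : label) : {l1 = l2} + {l1 <> l2}.
Proof. decide equality. Defined.

HB.instance Definition _ := comparableMixin label_eq_dec.

Definition prem_arity (l : label) (k : nat) : bool :=
  match l with
  | Ax | One | Bot | Bang => k == 0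
  | Der | Bullet => k == 1
  | Cut | Tens | Par => k == 2
  | Why => true
  end.

Definition concl_arity (l : label) (k : nat) : bool :=
  match l with
  | Cut | Bullet => k == 0
  | One | Bot | Tens | Par | Der | Why => k == 1
  | Ax => k == 2
  | Bang => 0 < k
  end.

Definition total_order_on (T : finType) (A : {set T}) (r : rel T) : Prop :=
  [/\ {in A &, antisymmetric r}, {in A & &, transitive r} & {in A &, total r}].

Definition struct_conclusions (G : graph) (lab : node G -> label) :
  {set arc G} := [set a | lab (head a) == Bullet].

(* The three orders are relations on all arcs, of which only the restriction
   to the relevant sets of arcs is meaningful. *)
Record ground : Type := Ground {
  gr :> graph;
  lab : node gr -> label;
  prem_arityP : forall n, prem_arity (lab n) #|premises n|;
  concl_arityP : forall n, concl_arity (lab n) #|conclusions n|;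
  concl_le : rel (arc gr);
  concl_leP : total_order_on (struct_conclusions lab) concl_le;
  bang_le : rel (arc gr);
  bang_leP : forall n, lab n = Bang -> total_order_on (conclusions n) bang_le;
  mult_le : rel (arc gr);
  mult_leP : forall n, lab n = Tens \/ lab n = Par ->
    total_order_on (premises n) mult_le }.

Section Grounds.
Variable G : ground.
Implicit Types (n : node G) (a : arc G).

Definition principal a : bool :=
  (lab (tail a) == Bang) && [forall b in conclusions (tail a), bang_le b a].

Definition weakenings : {set node G} :=
  [set n | (lab n == Bot) || ((lab n == Why) && (#|premises n| == 0))].

Definition switched n : bool :=
  (lab n == Par) || ((lab n == Why) && (2 <= #|premises n|)).

Definition switch_graph (phi : {n | switched n} -> arc G) : graph :=
  erase (fun a =>
    [exists k : {n : node G | switched n}, (head a == val k) && (a != phi k)]).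

Definition ACC_w_ground : Prop :=
  forall phi : {n | switched n} -> arc G,
    (forall k, phi k \in premises (val k)) ->
    acyclic (switch_graph phi) /\
    #|cc (switch_graph phi)| = #|weakenings| + 1.

(* A polarity labelling is given by its input arcs, all others being output. *)
Variable inp : pred (arc G).

Definition num_in (A : {set arc G}) : nat := #|[set a in A | inp a]|.
Definition num_out (A : {set arc G}) : nat := #|[set a in A | ~~ inp a]|.
Definition all_in (A : {set arc G}) : bool := [forall a in A, inp a].
Definition all_out (A : {set arc G}) : bool := [forall a in A, ~~ inp a].

Definition polarized_node n : bool :=
  match lab n with
  | Ax => (num_in (conclusions n) == 1) && (num_out (conclusions n) == 1)
  | Cut => (num_in (premises n) == 1) && (num_out (premises n) == 1)
  | One => all_out (conclusions n)
  | Bot | Der => all_in (conclusions n)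
  | Bang => [forall a in conclusions n, inp a == ~~ principal a]
  | Why => all_in (premises n) && all_in (conclusions n)
  | Tens => all_out (premises n) && all_out (conclusions n)
            || (num_in (premises n) == 1) && all_in (conclusions n)
  | Par => all_in (premises n) && all_in (conclusions n)
           || (num_in (premises n) == 1) && all_out (conclusions n)
  | Bullet => true
  end.

Definition polarized_ground : Prop := forall n, polarized_node n.

Definition par_out n : bool := (lab n == Par) && all_out (conclusions n).

Definition par_out_terminal_ground : Prop :=
  forall a, par_out (tail a) -> par_out (head a) \/ lab (head a) = Bullet.

Definition classical_ders : {set node G} :=
  [set n | (lab n == Der) && all_out (premises n)].

Definition out_bullets : {set node G} :=
  [set n | (lab n == Bullet) && all_out (premises n)].

Definition io_graph : graph :=
  @reverse (erase (fun a : arc G => par_out (head a) && inp a))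
    (fun e => inp (val e)).

Definition ACC_io_ground : Prop :=
  dacyclic io_graph /\ #|classical_ders| + #|out_bullets| = 1.

End Grounds.

(* Boxes carry their own types of nodes and arcs, hence are automatically
   disjoint from one another and from the ground-structure. *)
Inductive pre_structure : Type :=
  Pre (G : ground) of (forall n : node G, lab n == Bang -> pre_structure).

Definition ground_of (R : pre_structure) : ground := let: Pre G _ := R in G.
Coercion ground_of : pre_structure >-> ground.

Definition box (R : pre_structure) :
    forall n : node R, lab n == Bang -> pre_structure :=
  match R return forall n : node R, lab n == Bang -> pre_structure with
  | Pre _ b => b
  end.
Arguments box : clear implicits.

Fixpoint well_formed (R : pre_structure) : Prop :=
  let: Pre G b := R in
  forall (n : node G) (hn : lab n == Bang),
    #|struct_conclusions (@lab (b n hn))| = #|conclusions n| /\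
    well_formed (b n hn).

Record proof_structure : Type := ProofStructure {
  pre :> pre_structure;
  pre_wf : well_formed pre }.

Fixpoint hereditarily (P : ground -> Prop) (R : pre_structure) : Prop :=
  let: Pre G b := R in
  P G /\ forall (n : node G) (hn : lab n == Bang), hereditarily P (b n hn).

Definition ACC_w : pre_structure -> Prop := hereditarily ACC_w_ground.

Fixpoint polarity (R : pre_structure) : Type :=
  let: Pre G b := R in
  (pred (arc G) * forall (n : node G) (hn : lab n == Bang),
                    polarity (b n hn))%type.

Fixpoint pol_hereditarily (P : forall G : ground, pred (arc G) -> Prop)
    (R : pre_structure) : polarity R -> Prop :=
  match R return polarity R -> Prop with
  | Pre G b => fun pol =>
      P G pol.1 /\ forall (n : node G) (hn : lab n == Bang),
        pol_hereditarily P (pol.2 n hn)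
  end.

Definition polarized : forall R, polarity R -> Prop :=
  pol_hereditarily polarized_ground.
Definition par_out_terminal : forall R, polarity R -> Prop :=
  pol_hereditarily par_out_terminal_ground.
Definition ACC_io : forall R, polarity R -> Prop :=
  pol_hereditarily ACC_io_ground.

Section Extension.
Variables (R : pre_structure) (n : node R).

Definition alone : Prop :=
  (forall a : arc R, tail a = n) /\
  (forall m : node R, m <> n ->
     lab m = Bullet /\ exists a : arc R, tail a = n /\ head a = m).

Definition below (m : node R) : Prop :=
  exists a : arc R, tail a = n /\ head a = m.

Definition terminal : Prop :=
  forall a : arc R, tail a = n -> lab (head a) = Bullet.

(* [fn] and [fa] embed [R1] into [R], except that the bullets in [S] are
   removed: they are collapsed onto [n], so that the conclusions of [R1] above
   them become premises of [n]. The order of conclusions is ignored. *)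
Record embedding (R1 : pre_structure) (S : {set node R1})
    (fn : node R1 -> node R) (fa : arc R1 -> arc R) : Prop := Embedding {
  emb_bullet : forall m, m \in S -> lab m = Bullet;
  emb_removed : forall m, fn m = n <-> m \in S;
  emb_node_inj : {in ~: S &, injective fn};
  emb_arc_inj : injective fa;
  emb_tail : forall a, tail (fa a) = fn (tail a);
  emb_head : forall a, head (fa a) = fn (head a);
  emb_lab : {in ~: S, forall m, lab (fn m) = lab m};
  emb_bang_le : forall a b, tail a = tail b -> lab (tail a) = Bang ->
    bang_le (fa a) (fa b) = bang_le a b;
  emb_mult_le : forall a b, head a = head b ->
    lab (head a) = Tens \/ lab (head a) = Par ->
    mult_le (fa a) (fa b) = mult_le a b;
  emb_box : forall m (h : lab m == Bang) (h' : lab (fn m) == Bang),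
    box R (fn m) h' = box R1 m h }.

(* [R] is obtained from [R1] by adding the terminal node [n], whose premises
   are the conclusions of [R1] above the bullets in [S]. *)
Definition unary_extension (R1 : pre_structure) (S : {set node R1}) : Prop :=
  terminal /\
  exists fn fa,
    [/\ embedding S fn fa,
        forall a, tail a <> n <-> exists a1, fa a1 = a
      & forall m, m <> n /\ ~ below m <-> exists2 m1, m1 \notin S & fn m1 = m].

(* [R] is obtained from the disjoint union of [R1] and [R2] by adding the
   terminal node [n], whose premises are the conclusion of [R1] above [b1] and
   the conclusion of [R2] above [b2]. *)
Definition binary_extension (R1 R2 : pre_structure)
    (b1 : node R1) (b2 : node R2) : Prop :=
  terminal /\
  exists fn1 fa1 fn2 fa2,
    [/\ embedding [set b1] fn1 fa1 /\ embedding [set b2] fn2 fa2,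
        forall a1 a2, fa1 a1 <> fa2 a2,
        forall m1 m2, m1 != b1 -> m2 != b2 -> fn1 m1 <> fn2 m2,
        forall a, tail a <> n <->
          (exists a1, fa1 a1 = a) \/ (exists a2, fa2 a2 = a)
      & forall m, m <> n /\ ~ below m <->
          (exists2 m1, m1 != b1 & fn1 m1 = m) \/
          (exists2 m2, m2 != b2 & fn2 m2 = m)].

End Extension.

Inductive sequential : proof_structure -> Prop :=
| Sequential (R : proof_structure) (n : node R) :
    n_sequential n -> sequential R
with n_sequential : forall R : proof_structure, node R -> Prop :=
| SeqAxiom (R : proof_structure) (n : node R) :
    lab n = Ax \/ lab n = One -> alone n -> n_sequential n
| SeqBang (R R1 : proof_structure) (n : node R) (hn : lab n == Bang) :
    alone n -> box R n hn = R1 -> sequential R1 -> n_sequential n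
| SeqBinary (R R1 R2 : proof_structure) (n : node R)
    (b1 : node R1) (b2 : node R2) :
    lab n = Cut \/ lab n = Tens -> binary_extension n b1 b2 ->
    sequential R1 -> sequential R2 -> n_sequential n
| SeqUnary (R R1 : proof_structure) (n : node R) (S : {set node R1}) :
    [\/ lab n = Bot, lab n = Par, lab n = Der | lab n = Why] ->
    prem_arity (lab n) #|S| -> unary_extension n S ->
    sequential R1 -> n_sequential n.

(* Main.v *)
From mathcomp Require Import all_boot zify.
(* Loaded after [seq], whose [head] would otherwise hide that of graphs. *)
Require Import Defs.

Set Implicit Arguments.
Unset Strict Implicit.
Unset Printing Implicit Defensive.

(* A graph is acyclic iff every non-empty set of arcs has a leaf, and directed
   acyclic iff its nodes carry a rank increasing along arcs. Both counting
   conditions say that ax, 1 and ! nodes outnumber cut and tensor nodes by one: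
   for ACC_w by counting the arcs of a switching graph by their heads (a forest
   has as many components as nodes minus arcs), for ACC_io by counting the
   output arcs both by tails and by heads.

   (1) => (2): a simple directed cycle of the i/o graph uses at most one premise
   of each switched node, so it survives in some switching graph.

   (2) => (3): a terminal bot, par, ?d or ? node can always be removed. If there
   is none, there is no output par either, since a highest-ranked one would be
   terminal; then i/o arcs are never erased. Take an output arc [e] into a cut
   or a terminal tensor [n], with a tail of minimal rank. By minimality, the
   i/o-ancestors of the tail of [e] meet no input arc other than conclusions:
   they form a tree of output tensors over ax, 1 and ! nodes, attached to the
   rest of the structure only by [e], so that [n] splits. If there is no such
   arc, only a single ax, 1 or ! node is left.

   (3) => (1): leaves and label counts are preserved by gluing. *)

(** * Cycles, leaves and ranks *)

Section GraphLemmas.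
Variable G : graph.
Implicit Types (x y z : node G) (a b : arc G) (C K : {set arc G}).

Definition incident a x : bool := (tail a == x) || (head a == x).

(** The arc [a] is the only arc of [C] at its end [x]. Loops are excluded, being cycles by
    themselves. The notion refers to a set of arcs, so that subgraphs need not be built. *)
Definition leaf C a x : bool :=
  [&& a \in C, incident a x, tail a != head a
    & [forall b in C, incident b x ==> (b == a)]].

Definition has_leaf C : bool := [exists a, exists x, leaf C a x].

Lemma leafP C a x :
  reflect [/\ a \in C, incident a x, tail a != head a
             & forall b, b \in C -> incident b x -> b = a] (leaf C a x).
Proof.
apply: (iffP and4P) => -[aC ax nl u]; split=> //.
  by move=> b bC bx; have /forall_inP/(_ b bC)/implyP/(_ bx)/eqP := u.
by apply/forall_inP => b bC; apply/implyP => bx; apply/eqP/u.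
Qed.

Lemma ustepC a x y : ustep a x y = ustep a y x.
Proof. by rewrite /ustep orbC. Qed.

Lemma ustepE a : ustep a (tail a) (head a).
Proof. by rewrite /ustep /dstep !eqxx. Qed.

Lemma ustep_incident a x y : ustep a x y -> incident a x.
Proof. by case/orP => /andP[tx hx]; rewrite /incident ?tx ?hx ?orbT. Qed.

Lemma incident_ustep a x : incident a x -> exists y, ustep a x y.
Proof.
case/orP => /eqP <-; first by exists (head a); apply: ustepE.
by exists (tail a); rewrite ustepC ustepE.
Qed.

Lemma ustep_loop a x : ustep a x x -> tail a = head a.
Proof. by rewrite /ustep orbb => /andP[/eqP-> /eqP->]. Qed.

Lemma ustep_other a x y z : tail a != head a -> ustep a x y -> ustep a z y -> x = z.
Proof.
move/eqP=> nl; case/orP => /andP[/eqP <- /eqP <-]; case/orP => /andP[/eqP h /eqP h'] //.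
by rewrite h' in nl.
Qed.

(** The clause of [is_path] on first and last arcs reduces to the first arc of [q] being other than
    [a]; it is vacuous when [q] is empty, that is, for a loop. *)
Lemma is_cycle_rcons (step : arc G -> rel (node G)) x q a :
  walk step x (rcons q (a, x)) -> uniq (x :: unzip2 q) ->
  (forall b y q', q = (b, y) :: q' -> b <> a) -> is_cycle step x (rcons q (a, x)).
Proof.
move=> w u d; split; last 2 first.
- by rewrite size_rcons.
- by rewrite /unzip2 map_rcons last_rcons.
split=> //.
- move=> i j ij; rewrite size_rcons => jq.
  rewrite /unzip2 map_rcons -rcons_cons !nth_rcons /= size_map.
  have -> : i < (size q).+1 by lia.
  case: ltngtP jq => // [jq _|ej _]; last first.
    move: ij; rewrite {}ej => ij.
    case: i ij => // i ij /= e; move: u; rewrite /= -{1}e => /andP[].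
    by rewrite mem_nth // size_map; lia.
  move/eqP; rewrite -[nth _ (x :: _) i]/(nth x (x :: unzip2 q) i).
  rewrite -[nth _ (x :: _) j]/(nth x (x :: unzip2 q) j).
  rewrite nth_uniq //= ?size_map ?ltnS; lia.
rewrite size_rcons ltnS => q0 b; rewrite /unzip1 map_rcons /= nth_rcons size_map q0.
rewrite nth_rcons size_map ltnn eqxx.
by case: q q0 d {w u} => // -[c y] q _ d /=; apply: d.
Qed.

Lemma walk_cat (step : arc G -> rel (node G)) x p q :
  walk step x (p ++ q) = walk step x p && walk step (last x (unzip2 p)) q.
Proof. by elim: p x => //= -[a y] p IH x; rewrite IH andbA. Qed.

Lemma walk_nth (step : arc G -> rel (node G)) x p a0 i :
  walk step x p -> i < size p ->
  step (nth a0 (unzip1 p) i) (nth x (x :: unzip2 p) i) (nth x (x :: unzip2 p) i.+1).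
Proof.
rewrite -[nth x (x :: _) i.+1]/(nth x (unzip2 p) i).
elim: p x i => //= -[a y] p IH x [|i] /= /andP[s w] ip //.
rewrite (set_nth_default y x); last by rewrite /= size_map ltnW.
rewrite (set_nth_default y x) ?size_map //.
exact: IH.
Qed.

(** Without a leaf, a path starting with an arc of [C] can always be prolonged at its start by
    another arc of [C]. Nodes being finitely many, the new node eventually lies on the path, which
    closes a cycle. *)
Lemma acyclic_has_leaf : acyclic G -> forall C, C != set0 -> has_leaf C.
Proof.
move=> acy C; apply: contraTT => /existsPn nleaf.
have noloop b : tail b != head b.
  apply/eqP => e; apply: (acy (tail b) (rcons [::] (b, tail b))).
  by apply: is_cycle_rcons => //=; rewrite andbT {2}e ustepE.
have next a x : a \in C -> incident a x -> exists2 b, b \in C & incident b x && (b != a).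
  move=> aC ax; have /existsPn/(_ x) := nleaf a.
  rewrite /leaf aC ax noloop /= => /forall_inPn[b bC].
  by rewrite negb_imply; exists b.
(* [k] is the fuel: the nodes of a path are distinct, so it can be prolonged only until its length
   exhausts the nodes of [G]. *)
suff dead k x a y p : #|node G| <= size p + k -> a \in C ->
    walk (@ustep G) x ((a, y) :: p) -> uniq (x :: y :: unzip2 p) -> False.
  apply/negPn/eqP/setP => a; rewrite inE; apply/negP => aC.
  apply: (dead #|node G| (tail a) a (head a) [::]) => //=.
    by rewrite ustepE.
  by rewrite inE noloop.
elim: k x a y p => [|k IH] x a y p kp aC w u.
  have := leq_trans (max_card (mem (x :: y :: unzip2 p))) kp.
  by rewrite (card_uniqP u) /= size_map; lia.
have /andP[/= s w'] := w.
have [b bC /andP[bx ba]] := next a x aC (ustep_incident s).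
have [z bxz] := incident_ustep bx.
have zx : z != x.
  by apply: contra (noloop b) => /eqP e; rewrite e in bxz; rewrite (ustep_loop bxz).
have [/mapP[[a' z'] /= cp ez]|zp] := boolP (z \in unzip2 ((a, y) :: p)); last first.
  apply: (IH z b x ((a, y) :: p)) => //=.
  - by rewrite addSn -addnS.
  - by rewrite ustepC bxz.
  - by rewrite inE negb_or zx; exact/andP.
subst z'; set p0 := (a, y) :: p in w cp.
have {}u : uniq (x :: unzip2 p0) by [].
have ep0 : ohead p0 = Some (a, y) by [].
move: p0 cp w u ep0 => p0 /splitPr[p1 p2]; rewrite -cat_rcons walk_cat.
rewrite /unzip2 map_cat map_rcons -cat_cons cat_uniq -rcons_cons rcons_uniq.
rewrite inE negb_or => /andP[w1 _] /andP[/andP[/andP[_ zp1] u1] _] ep0.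
apply: (acy z (rcons ((b, x) :: p1) (a', z))); apply: is_cycle_rcons.
- by rewrite rcons_cons /= ustepC bxz.
- by rewrite [unzip2 _]/= cons_uniq inE negb_or zx zp1.
(* The closing arc [a'] is not [b]: if [p1] is empty it is [a]; otherwise it joins [z] to the last
   node of [p1], which would have to be [x]. *)
move=> _ _ _ [<- _ _] eba; move: ep0; case/lastP: p1 w1 zp1 u1 => [|p1 [c1 z1]] /=.
  by move=> _ _ _ [e]; rewrite eba e eqxx in ba.
rewrite -!cats1 walk_cat /unzip2 !map_cat last_cat /= andbT => /andP[_].
rewrite -eba => z1z _ /andP[xz1 _] _.
move: xz1; rewrite mem_cat inE => /norP[_ /eqP]; apply.
exact: (ustep_other (noloop b) bxz z1z).
Qed.

(** Unless it is a loop, an arc of a cycle meets a different arc of the cycle at each of its ends,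
    so the arcs of a cycle have no leaf. *)
Lemma has_leaf_acyclic : (forall C, C != set0 -> has_leaf C) -> acyclic G.
Proof.
move=> hl x p [[w uN d] p0 px].
have [a0 _] : exists a0 : arc G, true by case: (p) p0 => // -[a0 ?] ?; exists a0.
pose A i := nth a0 (unzip1 p) i; pose N i := nth x (x :: unzip2 p) i.
have Nk : N (size p) = x.
  by move: px; rewrite (last_nth x) size_map.
have st i : i < size p -> ustep (A i) (N i) (N i.+1) by apply: walk_nth.
have stl i : i < size p -> incident (A i) (N i) by move/st; apply: ustep_incident.
have str i : i < size p -> incident (A i) (N i.+1).
  by move/st; rewrite ustepC; apply: ustep_incident.
pose C := [set a in unzip1 p].
have AC i : i < size p -> A i \in C by move=> ip; rewrite inE mem_nth ?size_map.
(* If consecutive arcs were equal, the nodes [i] and [i.+2] would coincide, which only a cycle of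
   length 2 allows; there the first and last arcs are distinct by definition. *)
have adj i : i.+1 < size p -> tail (A i) != head (A i) -> A i <> A i.+1.
  move=> ip nl e; have := st _ ip; rewrite -e ustepC => s2.
  have e2 := ustep_other nl (st _ (ltnW ip)) s2.
  have [i0 ek] := uN i i.+2 (leqnSn _) ip e2.
  by have := d _ a0; rewrite -ek /=; rewrite i0 in e * => /(_ isT); apply.
have wrap : 0 < size p -> tail (A 0) != head (A 0) -> A 0 <> A (size p).-1.
  move=> k0 nl e; have [k1|k1] := ltnP 1 (size p); first exact: (d k1 a0).
  have ek : size p = 1 by lia.
  by have := st 0 k0; rewrite -ek Nk => /ustep_loop el; rewrite el eqxx in nl.
have /hl/existsP[a /existsP[z /leafP[aC az nl uz]]] : C != set0.
  by apply/set0Pn; exists (A 0); apply: AC.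
move: aC; rewrite inE => /(nthP a0)[i]; rewrite size_map => ip ea.
rewrite -/(A i) in ea; rewrite -{}ea in az nl uz.
have /orP[/eqP ez|/eqP ez] : (z == N i) || (z == N i.+1).
  by case/orP: (st i ip) az => /andP[/eqP <- /eqP <-]; rewrite /incident !(eq_sym z) // orbC.
- case: i ip az nl uz ez => [|i] ip az nl uz ez.
    apply: wrap => //; symmetry; apply: uz; first by apply: AC; lia.
    by rewrite ez -[N 0]Nk -{2}(prednK p0) str //; lia.
  have e : A i = A i.+1 by apply: uz; [apply: AC; lia | rewrite ez str //; lia].
  by apply: (adj i) => //; rewrite e.
- have [ip'|ip'] := ltnP i.+1 (size p).
    by apply: (adj i) => //; symmetry; apply: uz; [apply: AC | rewrite ez stl].
  have ei : i.+1 = size p by lia.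
  have e0 : A 0 = A i.
    by apply: uz; [apply: AC | rewrite ez ei Nk -[x]/(N 0) stl].
  by apply: wrap; rewrite ?e0 // -ei.
Qed.

Lemma dacyclic_rank :
  dacyclic G -> exists rho : node G -> nat, forall a, rho (tail a) < rho (head a).
Proof.
move=> dac; pose e := [rel x y : node G | [exists a, dstep a x y]].
(* The rank counts the nodes that reach [x]. The set grows strictly along an arc: [head a] reaches
   itself, and if it reached [tail a] a directed cycle would close. *)
exists (fun x => #|[set y | connect e y x]|) => a; apply: proper_card.
have ea : e (tail a) (head a) by apply/existsP; exists a; rewrite /dstep !eqxx.
apply/properP; split.
  apply/subsetP => y; rewrite !inE => h; apply: connect_trans h _.
  exact: connect1.
exists (head a); first by rewrite inE connect0.
rewrite inE; apply/negP => /connectP[q0 /shortenP[q pq uq _] et].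
have [p wp ep] : exists2 p, walk (@dstep G) (head a) p & unzip2 p = q.
  elim: (q) (head a) pq => [|y q' IH] x /=; first by exists [::].
  by move=> /andP[/existsP[b bx] /IH[p wp ep]]; exists ((b, y) :: p) => /=; rewrite ?bx ?ep.
apply: (dac (head a) (rcons p (a, head a))); apply: is_cycle_rcons.
- by rewrite -cats1 walk_cat wp /= ep -et /dstep !eqxx.
- by rewrite ep.
move=> b y q' eq eb; move: wp uq et; rewrite -ep eq eb /= => /andP[/andP[/eqP tb _] _].
move=> /andP[nin _] et; case/negP: nin; rewrite -tb et; exact: mem_last.
Qed.

Lemma rank_dacyclic (rho : node G -> nat) :
  (forall a, rho (tail a) < rho (head a)) -> dacyclic G.
Proof.
move=> hr x p [[w _ _] p0 px].
suff mono y q : walk (@dstep G) y q -> rho y + size q <= rho (last y (unzip2 q)).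
  by have := mono _ _ w; rewrite px; lia.
elim: q y => [|[a z] q IH] y /=; first by rewrite addn0.
move=> /andP[/andP[/eqP <- /eqP <-] /IH]; have := hr a; lia.
Qed.

(** Forgets the order of traversal and keeps what the comparison with switching graphs uses: a
    successor and a predecessor for each arc, and distinct tails. *)
Lemma dcycle_circuit x p : is_cycle (@dstep G) x p ->
  exists C, [/\ C != set0, {in C, forall a, exists2 b, b \in C & tail b = head a},
    {in C, forall a, exists2 b, b \in C & head b = tail a} & {in C &, injective tail}].
Proof.
move=> [[w uN _] p0 px].
have [a0 _] : exists a0 : arc G, true by case: (p) p0 => // -[a0 ?] ?; exists a0.
pose A i := nth a0 (unzip1 p) i; pose N i := nth x (x :: unzip2 p) i.
have Nk : N (size p) = x.
  by move: px; rewrite (last_nth x) size_map.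
have st i : i < size p -> tail (A i) = N i /\ head (A i) = N i.+1.
  by move=> ip; have /andP[/eqP-> /eqP->] := walk_nth a0 w ip.
pose C := [set a in unzip1 p].
have AC i : i < size p -> A i \in C by move=> ip; rewrite inE mem_nth ?size_map.
have CA a : a \in C -> exists2 i, i < size p & a = A i.
  by rewrite inE => /(nthP a0)[i]; rewrite size_map; exists i.
exists C; split.
- by apply/set0Pn; exists (A 0); apply: AC.
- move=> _ /CA[i ip ->]; have [_ ->] := st i ip.
  have [ip'|ip'] := ltnP i.+1 (size p); first by exists (A i.+1); rewrite ?AC ?(st _ ip').1.
  have -> : i.+1 = size p by lia.
  by exists (A 0); rewrite ?AC ?(st _ p0).1 ?Nk.
- move=> _ /CA[[|i] ip ->]; have [-> _] := st _ ip.
    have kp : (size p).-1 < size p by lia.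
    by exists (A (size p).-1); rewrite ?AC ?(st _ kp).2 // prednK.
  by exists (A i); rewrite ?AC ?(st _ (ltnW ip)).2 // ltnW.
move=> _ _ /CA[i ip ->] /CA[j jp ->]; rewrite (st _ ip).1 (st _ jp).1 => e.
have [ij|ji|-> //] := ltngtP i j.
  by have [_] := uN i j ij (ltnW jp) e; lia.
by have [_] := uN j i ji (ltnW ip) (esym e); lia.
Qed.

End GraphLemmas.

(** * Components of forests *)

(** [f] factors through [g] by a choice of preimages; [t0] is the default value where there is no
    preimage. *)
Lemma leq_card_imset_ker (T U V : finType) (f : T -> U) (g : T -> V) :
  (forall u w, g u = g w -> f u = f w) -> #|f @: setT| <= #|g @: setT|.
Proof.
move=> fg; have [/eqP e|/set0Pn[t0 _]] := boolP ([set: T] == set0).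
  by rewrite e imset0 cards0.
pose s v := odflt t0 [pick u | g u == v].
rewrite (_ : f @: setT = (f \o s) @: (g @: setT)) ?leq_imset_card //.
rewrite -imset_comp; apply: eq_imset => u /=; apply: fg.
by rewrite /s; case: pickP => [w /eqP ->|/(_ u)] //; rewrite eqxx.
Qed.

Section Forests.
Variable G : graph.
Implicit Types (x y z : node G) (a b : arc G) (C K : {set arc G}).

(* With [v] the gluing node, leaves of the parts are leaves of the whole. *)
Lemma leaf_avoiding C : (forall C', C' \subset C -> C' != set0 -> has_leaf C') ->
  C != set0 -> forall v, exists a x, leaf C a x /\ x != v.
Proof.
have [k] := ubnP #|C|; elim: k C => // k IH C Ck hl C0 v.
have /existsP[a /existsP[x lf]] := hl C (subxx _) C0.
have [exv|xv] := eqVneq x v; last by exists a, x.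
have /leafP[aC ax nl uz] := lf.
have [y axy] := incident_ustep ax; have ay : incident a y.
  by move: axy; rewrite ustepC => /ustep_incident.
have yx : y != x.
  by apply: contra nl => /eqP e; rewrite e in axy; rewrite (ustep_loop axy).
have [/eqP C'0|C'n0] := boolP (C :\ a == set0).
  exists a, y; rewrite -exv; split=> //; apply/leafP; split=> // b bC _.
  by move/setP/(_ b): C'0; rewrite !inE bC andbT => /negbFE/eqP.
(* The leaf found is at [v] itself: drop [a] and take a leaf of the rest at some [z] other than [y].
   As [a] ends only at [x] and [y], and [z] is neither, putting [a] back does not spoil it. *)
have [||b [z [/leafP[bC' bz nlb ub] zy]]] := IH (C :\ a) _ _ C'n0 y.
- by rewrite (cardsD1 a) aC in Ck; lia.
- by move=> C' /subset_trans sC'; apply: hl; apply/sC'/subD1set.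
have [ba bC] : b != a /\ b \in C by apply/andP; rewrite !inE in bC'.
have zx : z != x by apply: contra ba => /eqP e; rewrite (uz b bC) // -e.
exists b, z; rewrite -exv; split=> //; apply/leafP; split=> // c cC cz.
have [ca|ca] := eqVneq c a; last by apply: ub => //; rewrite !inE ca.
rewrite ca in cz; have /orP[/eqP e|/eqP e] : (z == x) || (z == y).
- by case/orP: axy cz => /andP[/eqP <- /eqP <-]; rewrite /incident !(eq_sym z) // orbC.
- by rewrite e eqxx in zx.
- by rewrite e eqxx in zy.
Qed.

Definition adjacent_in K : rel (node G) := [rel x y | [exists a in K, ustep a x y]].

Lemma adjacent_in_sym K : connect_sym (adjacent_in K).
Proof.
apply: sym_connect_sym => x y /=.
by apply: eq_existsb => a; rewrite ustepC.
Qed.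

(** Induction removing a leaf arc: without it [x] is isolated, so putting it back merges exactly two
    components. [r] sends each node to a representative of its component. *)
Lemma components_in K : (forall C, C \subset K -> C != set0 -> has_leaf C) ->
  exists2 r : node G -> node G,
    (forall u w, (r u == r w) = connect (adjacent_in K) u w)
    & #|r @: setT| + #|K| = #|node G|.
Proof.
have [k] := ubnP #|K|; elim: k K => // k IH K Kk hl.
have [->|K0] := eqVneq K set0.
  exists id; last by rewrite cards0 addn0 card_imset // cardsT.
  move=> u w; apply/eqP/idP => [->|]; first exact: connect0.
  case/connectP => -[|z p] //= /andP[/existsP[a]].
  by rewrite inE.
have /existsP[a /existsP[x /leafP[aK ax nl ux]]] := hl K (subxx _) K0.
have [y axy] := incident_ustep ax.
have yx : y != x.
  by apply: contra nl => /eqP e; rewrite e in axy; rewrite (ustep_loop axy).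
have [||r rP cr] := IH (K :\ a).
- by rewrite (cardsD1 a) aK in Kk; lia.
- by move=> C /subset_trans sC; apply: hl; apply/sC/subD1set.
have rxy : r x != r y.
  rewrite rP; apply/negP => /connectP[[|z p] /=]; first by move=> _ e; rewrite e eqxx in yx.
  case/andP => /existsP[b /andP[]]; rewrite !inE => /andP[ba bK] /ustep_incident bx.
  by rewrite (ux b bK bx) eqxx in ba.
(* The class of [x] takes over the representative of [y]. *)
pose r' u := if r u == r x then r y else r u.
have sub u w : r u = r w -> connect (adjacent_in K) u w.
  move/eqP; rewrite rP; apply: connect_sub => {}u {}w /existsP[b /andP[bK buw]].
  by apply/connect1/existsP; exists b; rewrite buw andbT; case/setD1P: bK.
have cxy : connect (adjacent_in K) x y.
  by apply/connect1/existsP; exists a; rewrite aK.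
have cyx : connect (adjacent_in K) y x by rewrite adjacent_in_sym.
exists r'.
  move=> u w; apply/eqP/idP.
    rewrite /r'; case: eqP => [/sub ux'|_]; case: eqP => [/sub wx|_].
    - by move=> _; rewrite adjacent_in_sym in wx; apply: connect_trans ux' wx.
    - by move/sub => yw; apply/(connect_trans ux')/(connect_trans cxy).
    - by rewrite adjacent_in_sym in wx; move/sub => uy;
        apply/(connect_trans uy)/(connect_trans cyx).
    - exact: sub.
  case/connectP => p; elim: p u => [|z p IHp] u /=; first by move=> _ ->.
  move=> /andP[/existsP[b /andP[bK buz]] pz] ew; rewrite -(IHp z) // {p IHp pz ew}.
  have [eba|ba] := eqVneq b a.
    rewrite eba in buz.
    have: (u == x) && (z == y) || (u == y) && (z == x).
      by case/orP: axy buz => /andP[/eqP <- /eqP <-]; rewrite /ustep /dstep;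
        rewrite !(eq_sym u) !(eq_sym z) => /orP[]/andP[-> ->]; rewrite ?orbT.
    by case/orP => /andP[/eqP -> /eqP ->]; rewrite /r' eqxx; case: eqP.
  suff /eqP e : r u == r z by rewrite /r' e.
  by rewrite rP; apply/connect1/existsP; exists b; rewrite !inE ba bK.
rewrite -cr (cardsD1 a K) aK (cardsD1 (r x) (r @: setT)) imset_f //.
suff -> : r' @: setT = (r @: setT) :\ r x by lia.
apply/setP => w; rewrite !inE; apply/imsetP/andP => [[u _ ->]|[wx /imsetP[u _ ew]]].
  rewrite /r'; have [_|ux'] := eqVneq (r u) (r x); rewrite imset_f //.
  by rewrite eq_sym.
by exists u => //; rewrite /r' -ew (negPf wx).
Qed.

Lemma acyclic_cc : acyclic G -> #|cc G| + #|arc G| = #|node G|.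
Proof.
move=> acy; have [|r rP <-] := @components_in setT.
  by move=> C _; apply: acyclic_has_leaf.
have eadj : adjacent_in setT =2 @adjacent G.
  by move=> x y; apply: eq_existsb => a; rewrite inE.
pose cl x := [set y in setT | connect (@adjacent G) x y].
have clP x y : cl x = cl y <-> r x = r y.
  split=> [/setP/(_ y)|/eqP]; rewrite ?inE.
    by rewrite connect0 -(eq_connect eadj) -rP => /eqP.
  rewrite rP => cxy; apply/setP => z; rewrite !inE -!(eq_connect eadj).
  exact: (same_connect (adjacent_in_sym _)).
rewrite cardsT; congr (_ + _); apply/eqP; rewrite eqn_leq.
by apply/andP; split; apply: leq_card_imset_ker => x y /clP.
Qed.

End Forests.

(** * Switchings *)

Lemma card_set_sum (T : finType) (P : pred T) : #|[set x | P x]| = \sum_x P x.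
Proof. by rewrite cardsE -sum1_card big_mkcond. Qed.

Lemma card_fibers (T U : finType) (f : T -> U) (A : {set T}) :
  #|A| = \sum_u #|[set a in A | f a == u]|.
Proof.
rewrite -sum1_card (partition_big f predT) //=; apply: eq_bigr => u _.
by rewrite -sum1_card; apply: eq_bigl => a; rewrite inE.
Qed.

Definition produces (l : label) : bool := l \in [:: Ax; One; Bang].
Definition consumes (l : label) : bool := l \in [:: Cut; Tens].

Section GroundLemmas.
Variable G : ground.
Implicit Types (n : node G) (a b : arc G) (C : {set arc G}).

Definition balanced : Prop :=
  #|[set n : node G | produces (lab n)]| = #|[set n : node G | consumes (lab n)]| + 1.

(* The sets of arcs contained in some switching graph. *)
Definition switchable C : Prop :=
  {in C &, forall a b, head a = head b -> switched (head a) -> a = b}.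

Definition switching_acyclic : Prop :=
  forall C, C != set0 -> switchable C -> has_leaf C.

Lemma bullet_premise n : lab n = Bullet -> exists2 a, head a = n & forall b, head b = n -> b = a.
Proof.
move=> ln; have := prem_arityP n; rewrite ln => /cards1P[a ea].
exists a; first by have := set11 a; rewrite -ea inE => /eqP.
by move=> b hb; apply/eqP; rewrite -in_set1 -ea inE hb.
Qed.

Lemma bullet_tail a : lab (tail a) <> Bullet.
Proof.
move=> l; have := concl_arityP (tail a); rewrite l => /eqP/cards0_eq/setP/(_ a).
by rewrite !inE eqxx.
Qed.

Lemma single_conclusion n : lab n \in [:: One; Bot; Tens; Par; Der; Why] ->
  exists2 a, tail a = n & forall b, tail b = n -> b = a.
Proof.
move=> ln; have : #|conclusions n| == 1.
  by have := concl_arityP n; move: ln; rewrite !inE; case: (lab n).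
case/cards1P=> a ea; exists a.
  by have := set11 a; rewrite -ea inE => /eqP.
by move=> b hb; apply/eqP; rewrite -in_set1 -ea inE hb.
Qed.

Lemma bullet_leaf C a : lab (head a) = Bullet -> a \in C -> leaf C a (head a).
Proof.
move=> l aC; apply/leafP; split=> //; first by rewrite /incident eqxx orbT.
  by apply/eqP => e; apply: (@bullet_tail a); rewrite e.
move=> b _ /orP[/eqP e|/eqP e]; first by case: (@bullet_tail b); rewrite e.
by have [c _ u] := bullet_premise l; rewrite (u b e) (u a erefl).
Qed.

Lemma switched_premise n : switched n -> exists a, head a = n.
Proof.
move=> sn; suff /card_gt0P[a] : 0 < #|premises n| by rewrite inE => /eqP; exists a.
case/orP: sn => [/eqP l|/andP[_]]; last by lia.
by have := prem_arityP n; rewrite l => /eqP ->.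
Qed.

(** Each switched node selects a premise in [C] if it has one. For a switchable [C] this keeps all
    of [C]; for the empty set it merely provides some switching. *)
Lemma switching_extending C : exists phi : {n : node G | switched n} -> arc G,
  (forall k, phi k \in premises (val k)) /\
  (forall k a, a \in C -> head a = val k -> phi k \in C).
Proof.
have ex (k : {n : node G | switched n}) : exists a, (head a == val k) &&
    ([exists b in C, head b == val k] ==> (a \in C)).
  have [a ea] := switched_premise (valP k).
  have [/exists_inP[b bC eb]|_] := boolP [exists b in C, head b == val k].
    by exists b; rewrite eb.
  by exists a; rewrite ea eqxx.
exists (fun k => xchoose (ex k)); split=> k.
  by rewrite inE; case/andP: (xchooseP (ex k)).
move=> a aC ea; have /andP[_ /implyP] := xchooseP (ex k); apply.
by apply/exists_inP; exists a; rewrite ?ea.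
Qed.

(** A switchable set survives in the graph of a switching that extends it, and conversely every set
    of arcs of a switching graph is switchable; leaves are the same on both sides. *)
Lemma switching_acyclicP :
  (forall phi : {n : node G | switched n} -> arc G,
    (forall k, phi k \in premises (val k)) -> acyclic (switch_graph phi)) <->
  switching_acyclic.
Proof.
split=> [acy C C0 sC|sacy phi phiP].
  have [phi [phiP phiC]] := switching_extending C.
  have kept a : a \in C -> ~~ [exists k, (head a == val k) && (a != phi k)].
    move=> aC; apply/existsP => -[k /andP[/eqP ea /eqP]]; apply.
    apply: sC => //; rewrite ?ea; last exact: (valP k).
      exact: phiC ea.
    by have := phiP k; rewrite inE => /eqP.
  pose C' : {set arc (switch_graph phi)} := [set a | val a \in C].
  have /existsP[a /existsP[x /leafP[aC ax nl u]]] : has_leaf C'.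
    apply: acyclic_has_leaf; first exact: acy.
    have /set0Pn[a aC] := C0; apply/set0Pn; exists (Sub a (kept a aC)).
    by rewrite inE SubK.
  apply/existsP; exists (val a); apply/existsP; exists x; apply/leafP; split=> //.
    by rewrite inE in aC.
  move=> b bC bx; rewrite -(u (Sub b (kept b bC))) ?SubK //; last by rewrite inE SubK.
apply: has_leaf_acyclic => C C0.
have /existsP[a /existsP[x /leafP[/imsetP[a' a'C ->] ax nl u]]] : has_leaf (val @: C).
  apply: sacy.
    by have /set0Pn[a aC] := C0; apply/set0Pn; exists (val a); apply: imset_f.
  move=> _ _ /imsetP[a aC ->] /imsetP[b bC ->] e sn.
  have key (c : arc (switch_graph phi)) (h : switched (head (val c))) :
      val c = phi (Sub _ h).
    apply/eqP; apply/negPn/negP => ne; have /existsP := valP c; apply.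
    by exists (Sub _ h); rewrite SubK eqxx.
  have sb : switched (head (val b)) by rewrite -e.
  by rewrite (key a sn) (key b sb); congr (phi _); apply: val_inj.
apply/existsP; exists a'; apply/existsP; exists x; apply/leafP; split=> //.
by move=> b bC bx; apply: val_inj; apply: u => //; apply: imset_f.
Qed.

(** Kept arcs are counted by their heads, and the equation is checked at each node from its label: a
    switched node keeps one premise, any other node keeps all of them. *)
Lemma switch_graph_count (phi : {n : node G | switched n} -> arc G) :
  (forall k, phi k \in premises (val k)) ->
  #|arc (switch_graph phi)| + #|[set n : node G | produces (lab n)]| + #|weakenings G| =
  #|node G| + #|[set n : node G | consumes (lab n)]|.
Proof.
move=> phiP; pose kept : {set arc G} :=
  [set a | ~~ [exists k : {n : node G | switched n}, (head a == val k) && (a != phi k)]].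
have -> : #|arc (switch_graph phi)| = #|kept| by rewrite card_sig cardsE.
have -> : #|node G| = \sum_(n : node G) 1 by rewrite sum1_card.
rewrite (card_fibers (@head G)) /weakenings !card_set_sum -!big_split /=.
apply: eq_bigr => n _.
have keptE a : head a = n -> (a \in kept) = (if insub n is Some k then a == phi k else true).
  move=> ea; rewrite inE; case: insubP => [k _ ek|nsw].
    apply/existsPn/eqP => [/(_ k)|ak k']; first by rewrite ea ek eqxx negbK => /eqP.
    rewrite negb_and negbK; case: eqP => //= e; rewrite ak; apply/eqP.
    by congr phi; apply: val_inj; exact: etrans ek (etrans (esym ea) e).
  apply/existsPn => k; apply/nandP; left; apply: contra nsw => /eqP e.
  by rewrite -ea e (valP k).
have -> : #|[set a in kept | head a == n]| = if switched n then 1 else #|premises n|.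
  case: ifP => sn.
    pose k : {n : node G | switched n} := Sub n sn.
    rewrite -(cards1 (phi k)); apply: eq_card => a; rewrite !inE andbC.
    have := phiP k; rewrite inE => /eqP ek.
    have [ea|na] := eqVneq (head a) n; last first.
      by symmetry; apply/eqP => e; rewrite e ek eqxx in na.
    by have := keptE a ea; rewrite inE => ->; rewrite (insubT _ sn).
  apply: eq_card => a; rewrite [LHS]inE [RHS]inE.
  have [ea|na] := eqVneq (head a) n; last by rewrite andbF.
  by rewrite keptE // insubF.
have := prem_arityP n; rewrite /switched /produces /consumes.
by case: (lab n); rewrite /= ?inE /=; move: #|premises n| => [|[|[|k]]].
Qed.

Lemma ACC_w_groundE : ACC_w_ground G <-> switching_acyclic /\ balanced.
Proof.
split=> [acc|[sacy bal] phi phiP].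
  split; first by apply/switching_acyclicP => phi /acc[].
  (* Balance does not mention the switching, so any single one gives it. *)
  have [phi [phiP _]] := switching_extending set0.
  have [acy ecc] := acc phi phiP; have := acyclic_cc acy; have := switch_graph_count phiP.
  by rewrite /balanced ecc /=; lia.
have acy := switching_acyclicP.2 sacy phi phiP; split=> //.
have := acyclic_cc acy; have := switch_graph_count phiP; move: bal.
by rewrite /balanced /=; lia.
Qed.

End GroundLemmas.

(** * Gluing along sequentializing nodes *)

Lemma hereditarilyE (P : ground -> Prop) (R : pre_structure) :
  hereditarily P R <-> P R /\ forall n hn, hereditarily P (box R n hn).
Proof. by case: R. Qed.

Section Embedding.
Variables (R : pre_structure) (n : node R) (R1 : pre_structure) (S : {set node R1}).
Variables (fn : node R1 -> node R) (fa : arc R1 -> arc R).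
Hypothesis emb : embedding n S fn fa.

Lemma emb_inj x y : x \notin S -> fn y = fn x -> y = x.
Proof.
move=> xS e; apply: (emb_node_inj emb) => //; rewrite inE //.
by apply: contra xS => /(emb_removed emb) yn; apply/(emb_removed emb); rewrite -e.
Qed.

Lemma emb_incident a x : x \notin S -> incident (fa a) (fn x) -> incident a x.
Proof.
move=> xS; rewrite /incident (emb_tail emb) (emb_head emb).
by case/orP => /eqP/(emb_inj xS) ->; rewrite eqxx ?orbT.
Qed.

Lemma emb_notin x : lab x <> Bullet -> x \notin S.
Proof. by move=> lx; apply/negP => /(emb_bullet emb). Qed.

Lemma emb_switched x : switched x -> switched (fn x).
Proof.
move=> sx; have lx : lab (fn x) = lab x.
  by apply: (emb_lab emb); rewrite inE; apply: emb_notin => l; rewrite /switched l in sx.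
move: sx; rewrite /switched lx => /orP[-> //|/andP[-> le]]; rewrite (leq_trans le) ?orbT //.
rewrite -(card_imset _ (emb_arc_inj emb)); apply: subset_leq_card.
by apply/subsetP => _ /imsetP[a + ->]; rewrite !inE => /eqP ea; rewrite (emb_head emb) ea.
Qed.

Lemma emb_switchable (C : {set arc R}) : switchable C -> switchable (fa @^-1: C).
Proof.
move=> sC a b; rewrite !inE => aC bC e sh; apply: (emb_arc_inj emb).
by apply: sC; rewrite ?(emb_head emb) ?e //; apply: emb_switched; rewrite -e.
Qed.

(** [fn] merges only removed bullets, so an arc of the image that meets [fn x] comes from one that
    meets [x]; the last hypothesis rules out arcs outside the image. *)
Lemma emb_leaf (C : {set arc R}) a x : leaf (fa @^-1: C) a x -> x \notin S ->
  (forall b, b \in C -> incident b (fn x) -> exists b1, fa b1 = b) ->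
  leaf C (fa a) (fn x).
Proof.
move=> /leafP[aC ax nl u] xS im; rewrite inE in aC; apply/leafP; split=> //.
- by rewrite /incident (emb_tail emb) (emb_head emb); case/orP: ax => /eqP <-; rewrite eqxx ?orbT.
- rewrite (emb_tail emb) (emb_head emb); apply: contra nl => /eqP e.
  by case/orP: ax => /eqP ex; rewrite -ex in xS; apply/eqP;
    [rewrite (emb_inj xS (esym e)) | rewrite (emb_inj xS e)].
- move=> b bC bx; have [b1 eb] := im b bC bx; rewrite -eb in bC bx *.
  by congr fa; apply: u; rewrite ?inE //; apply: emb_incident.
Qed.

Lemma emb_count (P : pred label) : ~~ P Bullet ->
  #|fn @: [set m : node R1 | P (lab m)]| = #|[set m : node R1 | P (lab m)]|.
Proof.
move=> nP; apply: card_in_imset => x y; rewrite !inE => Px Py.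
by apply: emb_inj; apply: emb_notin => l; rewrite l (negPf nP) in Py.
Qed.

Lemma emb_imset_labelled (P : pred label) m :
  m \in fn @: [set m1 : node R1 | P (lab m1)] -> ~~ P Bullet -> P (lab m) /\ m <> n.
Proof.
move=> /imsetP[m1]; rewrite inE => Pm -> nP.
have m1S : m1 \notin S by apply: emb_notin => l; rewrite l (negPf nP) in Pm.
split; first by rewrite (emb_lab emb) // inE.
by move/(emb_removed emb); apply/negP.
Qed.

Lemma emb_hereditarily P m (hm : lab m == Bang) m1 :
  m1 \notin S -> fn m1 = m -> (forall h, hereditarily P (box R1 m1 h)) ->
  hereditarily P (box R m hm).
Proof.
move=> m1S em hP; have h1 : lab m1 == Bang by rewrite -(emb_lab emb) ?inE // em.
by subst m; rewrite (emb_box emb h1 hm).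
Qed.

End Embedding.

Section Extensions.
Variables (R : pre_structure) (n : node R).
Hypothesis term : terminal n.

Lemma below_bullet m : below n m -> lab m = Bullet.
Proof. by move=> [a [ta <-]]; apply: term. Qed.

Section Unary.
Variables (R1 : pre_structure) (S : {set node R1}).
Hypothesis lab_n : [\/ lab n = Bot, lab n = Par, lab n = Der | lab n = Why].
Hypothesis ext : unary_extension n S.

(** The nodes that the surviving nodes of [R1] do not reach are [n] and the bullets below it, and
    the removed nodes are bullets. If bullets are not counted, only [n] makes a difference. *)
Lemma unary_count (P : pred label) : ~~ P Bullet ->
  #|[set m : node R | P (lab m)]| = P (lab n) + #|[set m : node R1 | P (lab m)]|.
Proof.
move=> nP; have [_ [fn [fa [emb _ nodes]]]] := ext.
rewrite (cardsD1 n) inE -(emb_count emb nP); congr (_ + _); apply: eq_card => m.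
apply/idP/idP => [|/(emb_imset_labelled emb)/(_ nP)[Pm /eqP mn]]; last by rewrite !inE mn.
rewrite !inE => /andP[/eqP mn Pm].
have [|m1 m1S em] := (nodes m).1; last first.
  by rewrite -em imset_f // inE -(emb_lab emb) ?inE // em.
by split=> // /below_bullet l; rewrite l (negPf nP) in Pm.
Qed.

Lemma unary_balanced : balanced R1 -> balanced R.
Proof.
rewrite /balanced !unary_count //.
by case: lab_n => ->.
Qed.

(** An arc of [C] into a bullet is a leaf. Otherwise [C] avoids the conclusion of [n], and an arc of
    [C] into [n] is a leaf at [n], since by switchability or by arity no other premise of [n] is in
    [C]. Otherwise [C] lives in [R1], and a leaf there is not at a removed bullet. *)
Lemma unary_switching_acyclic : switching_acyclic R1 -> switching_acyclic R.
Proof.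
move=> acy C C0 sC; have [_ [fn [fa [emb arcs nodes]]]] := ext.
have [/exists_inP[a aC /eqP l]|/exists_inPn nb] :=
    boolP [exists a in C, lab (head a) == Bullet].
  by apply/existsP; exists a; apply/existsP; exists (head a); apply: bullet_leaf.
have tn a : a \in C -> tail a <> n by move=> /nb/eqP aC /term.
have [/exists_inP[a aC /eqP ha]|/exists_inPn hn] := boolP [exists a in C, head a == n].
  apply/existsP; exists a; apply/existsP; exists n; apply/leafP; split=> //.
  - by rewrite /incident ha eqxx orbT.
  - by rewrite ha; apply/eqP/tn.
  move=> b bC /orP[/eqP/(tn _ bC) //|/eqP hb].
  have [sn|nsn] := boolP (switched n); first by apply: sC; rewrite ?hb ?ha.
  apply: (card_le1_eqP (A := mem (premises n))); rewrite ?inE ?ha ?hb //.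
  move: nsn (prem_arityP n); rewrite /switched.
  by case: lab_n => -> //=; rewrite -?ltnNge // => _ /eqP ->.
have C10 : fa @^-1: C != set0.
  have /set0Pn[a aC] := C0; have [a1 ea] := (arcs a).1 (tn a aC).
  by apply/set0Pn; exists a1; rewrite inE ea.
have /existsP[a /existsP[x lf]] := acy _ C10 (emb_switchable emb sC).
apply/existsP; exists (fa a); apply/existsP; exists (fn x); apply: (emb_leaf emb) => //.
  have /leafP[aC ax _ _] := lf; rewrite inE in aC.
  apply/negP => /(emb_removed emb) xn; case/orP: ax => /eqP ex.
    by apply: (tn _ aC); rewrite (emb_tail emb) ex.
  by have /eqP := hn _ aC; rewrite (emb_head emb) ex.
by move=> b bC _; apply/arcs/tn.
Qed.

Lemma unary_hereditarily (P : ground -> Prop) : P R -> hereditarily P R1 -> hereditarily P R.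
Proof.
move=> PR /hereditarilyE[_ hP]; apply/hereditarilyE; split=> // m hm.
have [_ [fn [fa [emb _ nodes]]]] := ext.
have [|m1 m1S em] := (nodes m).1; last exact: (emb_hereditarily emb) em _.
split; first by move=> e; rewrite e in hm; case: lab_n hm => ->.
by move=> /below_bullet l; rewrite l in hm.
Qed.

End Unary.

Section Binary.
Variables (R1 R2 : pre_structure) (b1 : node R1) (b2 : node R2).
Hypothesis lab_n : lab n = Cut \/ lab n = Tens.
Hypothesis ext : binary_extension n b1 b2.

Lemma binary_count (P : pred label) : ~~ P Bullet ->
  #|[set m : node R | P (lab m)]| =
  P (lab n) + (#|[set m : node R1 | P (lab m)]| + #|[set m : node R2 | P (lab m)]|).
Proof.
move=> nP; have [_ [fn1 [fa1 [fn2 [fa2 [[emb1 emb2] _ dis _ nodes]]]]]] := ext.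
have nb1 m : P (lab m) -> m \notin [set b1].
  by move=> Pm; apply: (emb_notin emb1) => l; rewrite l (negPf nP) in Pm.
have nb2 m : P (lab m) -> m \notin [set b2].
  by move=> Pm; apply: (emb_notin emb2) => l; rewrite l (negPf nP) in Pm.
rewrite (cardsD1 n) inE -(emb_count emb1 nP) -(emb_count emb2 nP) -cardsUI.
rewrite [X in _ = _ + (_ + #|pred_of_set X|)](_ : _ = set0) ?cards0 ?addn0.
  congr (_ + _); apply: eq_card => m; rewrite in_setU; apply/idP/orP; last first.
    by case=> [/(emb_imset_labelled emb1)|/(emb_imset_labelled emb2)] /(_ nP)[Pm /eqP mn];
      rewrite !inE mn.
  rewrite !inE => /andP[/eqP mn Pm].
  have [|[m1 m1S em]|[m2 m2S em]] := (nodes m).1.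
  - by split=> // /below_bullet l; rewrite l (negPf nP) in Pm.
  - by left; rewrite -em imset_f // inE -(emb_lab emb1) ?inE // em.
  - by right; rewrite -em imset_f // inE -(emb_lab emb2) ?inE // em.
apply/setP => m; rewrite [RHS]inE in_setI; apply/andP => -[/imsetP[m1 h1 ->] /imsetP[m2 h2]].
by apply: dis; [move: h1; rewrite inE => /nb1 | move: h2; rewrite inE => /nb2]; rewrite inE.
Qed.

Lemma binary_hereditarily (P : ground -> Prop) :
  P R -> hereditarily P R1 -> hereditarily P R2 -> hereditarily P R.
Proof.
move=> PR /hereditarilyE[_ hP1] /hereditarilyE[_ hP2]; apply/hereditarilyE; split=> // m hm.
have [_ [fn1 [fa1 [fn2 [fa2 [[emb1 emb2] _ dis _ nodes]]]]]] := ext.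
have [|[m1 m1S em]|[m2 m2S em]] := (nodes m).1.
- split; first by move=> e; rewrite e in hm; case: lab_n hm => ->.
  by move=> /below_bullet l; rewrite l in hm.
- by apply: (emb_hereditarily emb1 hm _ em) => //; rewrite inE.
- by apply: (emb_hereditarily emb2 hm _ em) => //; rewrite inE.
Qed.

Lemma binary_balanced : balanced R1 -> balanced R2 -> balanced R.
Proof.
rewrite /balanced !binary_count //.
by case: lab_n => ->; rewrite /produces /consumes !inE /=; lia.
Qed.

(** Here [C] may contain both premises of [n], so a leaf of one part at its removed bullet could be
    lost. [leaf_avoiding] gives a leaf elsewhere, which no arc of the other part meets. *)
Lemma binary_switching_acyclic :
  switching_acyclic R1 -> switching_acyclic R2 -> switching_acyclic R.
Proof.
move=> acy1 acy2 C C0 sC.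
have [_ [fn1 [fa1 [fn2 [fa2 [[emb1 emb2] _ dis arcs nodes]]]]]] := ext.
have [/exists_inP[a aC /eqP l]|/exists_inPn nb] :=
    boolP [exists a in C, lab (head a) == Bullet].
  by apply/existsP; exists a; apply/existsP; exists (head a); apply: bullet_leaf.
have tn a : a \in C -> tail a <> n by move=> /nb/eqP aC /term.
have fb1 : fn1 b1 = n by apply/(emb_removed emb1); rewrite inE.
have fb2 : fn2 b2 = n by apply/(emb_removed emb2); rewrite inE.
have f1n x : x != b1 -> fn1 x <> n.
  by move=> xb /(emb_removed emb1); rewrite inE (negPf xb).
have f2n x : x != b2 -> fn2 x <> n.
  by move=> xb /(emb_removed emb2); rewrite inE (negPf xb).
have dis' x y : x != b1 -> fn1 x <> fn2 y.
  move=> xb; have [->|/dis] := eqVneq y b2; last exact.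
  by rewrite fb2; apply: f1n.
have dis'' x y : y != b2 -> fn1 x <> fn2 y.
  move=> yb; have [->|/dis] := eqVneq x b1; last exact.
  by rewrite fb1 => e; apply: (f2n y).
have [a aC] := set0Pn _ C0.
have [[a1 ea]|[a2 ea]] := (arcs a).1 (tn a aC).
  have C1 : fa1 @^-1: C != set0 by apply/set0Pn; exists a1; rewrite inE ea.
  have [|b [x [lf xb]]] := leaf_avoiding _ C1 b1.
    by move=> C' /subsetP sC' /acy1; apply=> c d /sC' + /sC'; apply: (emb_switchable emb1 sC).
  apply/existsP; exists (fa1 b); apply/existsP; exists (fn1 x).
  apply: (emb_leaf emb1) => //; first by rewrite inE.
  move=> c cC cx; have [//|[d ed]] := (arcs c).1 (tn c cC); exfalso.
  by case/orP: cx => /eqP; rewrite -ed ?(emb_tail emb2) ?(emb_head emb2) => e;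
    apply: (dis' x _ xb (esym e)).
have C2 : fa2 @^-1: C != set0 by apply/set0Pn; exists a2; rewrite inE ea.
have [|b [x [lf xb]]] := leaf_avoiding _ C2 b2.
  by move=> C' /subsetP sC' /acy2; apply=> c d /sC' + /sC'; apply: (emb_switchable emb2 sC).
apply/existsP; exists (fa2 b); apply/existsP; exists (fn2 x).
apply: (emb_leaf emb2) => //; first by rewrite inE.
move=> c cC cx; have [[d ed]|//] := (arcs c).1 (tn c cC); exfalso.
by case/orP: cx => /eqP; rewrite -ed ?(emb_tail emb1) ?(emb_head emb1) => e;
  apply: (dis'' _ x xb e).
Qed.

End Binary.
End Extensions.

Lemma alone_ACC_w (R : pre_structure) (n : node R) :
  lab n \in [:: Ax; One; Bang] -> alone n -> ACC_w_ground R.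
Proof.
move=> ln [ta bul]; have hb (a : arc R) : lab (head a) = Bullet.
  have [e|/eqP hn] := eqVneq (head a) n; last by case: (bul _ hn).
  have : 0 < #|premises n| by apply/card_gt0P; exists a; rewrite inE e.
  by have := prem_arityP n; move: ln; rewrite !inE; case: (lab n) => //= _ /eqP ->.
apply/ACC_w_groundE; split.
  move=> C /set0Pn[a aC] _; apply/existsP; exists a; apply/existsP; exists (head a).
  exact: bullet_leaf.
have lm (m : node R) : m != n -> lab m = Bullet by move=> /eqP mn; case: (bul m mn).
rewrite /balanced (_ : [set m | produces _] = [set n]); last first.
  by apply/setP => m; rewrite !inE; have [->|/lm ->//] := eqVneq m n.
rewrite (_ : [set m | consumes _] = set0) ?cards1 ?cards0 //.
apply/setP => m; rewrite !inE; have [->|/lm ->//] := eqVneq m n.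
by move: ln; rewrite !inE; case: (lab n).
Qed.

Scheme sequential_mind := Minimality for sequential Sort Prop
  with n_sequential_mind := Minimality for n_sequential Sort Prop.

Lemma sequential_ACC_w (R : proof_structure) : sequential R -> ACC_w R.
Proof.
move: R; apply: (sequential_mind (P := fun R : proof_structure => ACC_w R)
  (P0 := fun (R : proof_structure) _ => ACC_w R)) => //.
- move=> R n ln al; apply/hereditarilyE; split.
    by apply: (alone_ACC_w (n := n)) => //; case: ln => ->.
  move=> m hm; have [e|/eqP/(proj2 al)[l _]] := eqVneq m n; last by exfalso; rewrite l in hm.
  by exfalso; move: hm; rewrite e; case: ln => ->.
- move=> R R1 n hn al eb _ IH; apply/hereditarilyE; split.
    by apply: (alone_ACC_w (n := n)) => //; rewrite (eqP hn).
  move=> m hm; have [e|/eqP/(proj2 al)[l _]] := eqVneq m n; last by exfalso; rewrite l in hm.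
  by move: hm; rewrite e => hm; rewrite (eq_irrelevance hm hn) eb.
- move=> R R1 R2 n b1 b2 ln ext _ IH1 _ IH2; have term := ext.1.
  have /hereditarilyE[/ACC_w_groundE[s1 bal1] _] := IH1.
  have /hereditarilyE[/ACC_w_groundE[s2 bal2] _] := IH2.
  apply: (binary_hereditarily term ln ext) => //; apply/ACC_w_groundE; split.
    exact: (binary_switching_acyclic term ext).
  exact: (binary_balanced term ln ext).
move=> R R1 n S ln _ ext _ IH; have term := ext.1.
have /hereditarilyE[/ACC_w_groundE[s1 bal1] _] := IH.
apply: (unary_hereditarily term ln ext) => //; apply/ACC_w_groundE; split.
  exact: (unary_switching_acyclic term ln ext).
exact: (unary_balanced term ln ext).
Qed.

(** * Polarization *)

Lemma total_order_max (T : finType) (A : {set T}) (r : rel T) :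
  total_order_on A r -> A != set0 -> exists2 x, x \in A & {in A, forall y, r y x}.
Proof.
move=> [_ tr tot] /set0Pn[x0 x0A].
(* The greatest element is one with the most elements below it. *)
pose f x := #|[set y in A | r y x]|.
have [x xA xmax] := arg_maxnP f x0A; exists x => // y yA.
apply: contraT => nyx; have xy : r x y by have := tot x y xA yA; rewrite (negPf nyx) orbF.
have := xmax y yA; rewrite /= leqNgt; case/negP; apply: proper_card; apply/properP; split.
  apply/subsetP => z; rewrite !inE => /andP[zA zx]; rewrite zA /=.
  exact: tr zx xy.
exists y; rewrite !inE yA //=; first by have := tot y y yA yA; rewrite orbb.
Qed.

Section Polarity.
Variables (G : ground) (inp : pred (arc G)).
Implicit Types (n : node G) (a b : arc G) (A : {set arc G}).

Lemma num_in_out A : num_in inp A + num_out inp A = #|A|.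
Proof.
rewrite -(cardsID [set a | inp a] A) /num_in /num_out.
by congr (_ + _); apply: eq_card => a; rewrite !inE // andbC.
Qed.

Lemma num_out_all_out A : all_out inp A -> num_out inp A = #|A|.
Proof.
move=> /forall_inP h; apply: eq_card => a; rewrite !inE.
by case aA: (a \in A) => //=; apply: h.
Qed.

Lemma num_out_all_in A : all_in inp A -> num_out inp A = 0.
Proof.
move=> /forall_inP h; apply/eqP; rewrite cards_eq0; apply/eqP/setP => a; rewrite !inE.
by apply/negbTE; rewrite negb_and negbK orbC -implyNb; apply/implyP => na;
  apply: contra na => /h.
Qed.

Lemma num_out1 A : #|A| = 1 -> num_out inp A = all_out inp A.
Proof.
move=> /eqP/cards1P[a ->]; case ea: (inp a).
  rewrite num_out_all_in; last by apply/forall_inP => b; rewrite inE => /eqP ->.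
  by apply/esym/eqP; rewrite eqb0; apply/forall_inPn; exists a; rewrite ?inE ?ea.
have ao : all_out inp [set a] by apply/forall_inP => b; rewrite inE => /eqP ->; rewrite ea.
by rewrite num_out_all_out // ao cards1.
Qed.

Hypothesis polP : polarized_ground inp.

(** The output conclusions are the greatest ones; a greatest conclusion exists by totality and is
    unique by antisymmetry. *)
Lemma bang_num_out n : lab n = Bang -> num_out inp (conclusions n) = 1.
Proof.
move=> ln; have := polP n; rewrite /polarized_node ln => /forall_inP hp.
have C0 : conclusions n != set0.
  by rewrite -card_gt0; have := concl_arityP n; rewrite ln.
have tot := bang_leP ln; have [x xC xmax] := total_order_max tot C0.
have [anti _ _] := tot.
rewrite /num_out -(cards1 x); apply: eq_card => a; rewrite [RHS]inE [LHS]inE.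
have [->|ax] := eqVneq a x.
  rewrite xC (eqP (hp x xC)) negbK /principal; move: (xC); rewrite inE => /eqP ->.
  by rewrite ln eqxx /=; apply/forall_inP.
apply/negbTE/andP => -[aC]; rewrite (eqP (hp a aC)) negbK => /andP[_].
have ta : tail a = n by move: aC; rewrite inE => /eqP.
rewrite ta => /forall_inP/(_ x xC) xa; case/eqP: ax; apply: anti => //.
by rewrite xa xmax.
Qed.

Lemma num_out_conclusions n : num_out inp (conclusions n) <= 1.
Proof.
have := concl_arityP n; have := polP n; have := num_in_out (conclusions n).
rewrite /polarized_node; case ln: (lab n) => io /=; try by (move=> _ /eqP ec; lia).
  by case/andP => _ /eqP ->.
by rewrite bang_num_out.
Qed.

Lemma output_inj a b : ~~ inp a -> ~~ inp b -> tail a = tail b -> a = b.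
Proof.
move=> oa ob e; have /card_le1_eqP := num_out_conclusions (tail a); apply;
  by rewrite !inE ?oa ?ob ?e eqxx.
Qed.

Lemma polarized_count :
  #|[set n : node G | produces (lab n)]| =
  #|[set n : node G | consumes (lab n)]| + (#|classical_ders inp| + #|out_bullets inp|).
Proof.
pose O := [set a | ~~ inp a].
have eO (f : arc G -> node G) : #|O| = \sum_n num_out inp [set a | f a == n].
  rewrite (card_fibers f); apply: eq_bigr => n _; apply: eq_card => a.
  by rewrite !inE andbC.
have := eO (@head G); rewrite {1}(eO (@tail G)) => {}eO.
apply: (@addnI (\sum_n num_out inp (conclusions n))).
(* Output arcs are counted by heads on the left and by tails on the right; the equation then holds
   node by node, by inspection of the label. *)
rewrite [in LHS]eO /classical_ders /out_bullets !card_set_sum -!big_split /=.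
apply: eq_bigr => n _; rewrite -[[set a | _]]/(premises n).
have := prem_arityP n; have := concl_arityP n; have := polP n.
have := num_in_out (premises n); have := num_in_out (conclusions n).
have := @bang_num_out n; rewrite /polarized_node /produces /consumes.
case ln: (lab n) => bg; rewrite /= ?inE /=.
- by move=> _ io /andP[_ /eqP ->] _ /eqP ep; lia.
- by move=> io ec /andP[/eqP ep /eqP ->] /eqP; lia.
- by move=> io ep /num_out_all_out -> /eqP ec /eqP; lia.
- by move=> io ep /num_out_all_in -> /eqP ec /eqP; lia.
- move=> io ep
    /orP[/andP[/num_out_all_out -> /num_out_all_out ->]|/andP[/eqP ei /num_out_all_in ->]];
    move=> /eqP + /eqP; lia.
- move=> io ep
    /orP[/andP[/num_out_all_in -> /num_out_all_in ->]|/andP[/eqP ei /num_out_all_out ->]];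
    move=> /eqP + /eqP; lia.
- by move=> io ep _ _ /eqP; rewrite bg //; lia.
- by move=> io ep /num_out_all_in -> _ /eqP/num_out1 ->; lia.
- by move=> io ep /andP[/num_out_all_in -> /num_out_all_in ->].
- by move=> io ep _ /eqP e0 /eqP/num_out1 ->; lia.
Qed.

Lemma ACC_io_groundE : ACC_io_ground inp <-> dacyclic (io_graph inp) /\ balanced G.
Proof. by rewrite /ACC_io_ground /balanced polarized_count; split=> -[? ?]; split=> //; lia. Qed.

Lemma par_not_out n : lab n = Par -> ~~ par_out inp n ->
  all_in inp (premises n) && all_in inp (conclusions n).
Proof.
move=> ln; have := polP n; rewrite /polarized_node /par_out ln eqxx /=.
by case/orP => [-> //|/andP[_ ->]].
Qed.

Lemma par_out_premise n a b : par_out inp n -> head a = n -> head b = n ->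
  ~~ inp a -> ~~ inp b -> a = b.
Proof.
move=> /andP[/eqP ln ao] ha hb oa ob.
have : num_out inp (premises n) <= 1.
  have := num_in_out (premises n); have := prem_arityP n; rewrite ln => /eqP ->.
  have := polP n; rewrite /polarized_node ln => /orP[/andP[_ ai]|/andP[/eqP -> _]]; last by lia.
  have := num_out_all_in ai; rewrite (num_out_all_out ao).
  by have := concl_arityP n; rewrite ln => /eqP ->.
by move/card_le1_eqP; apply; rewrite !inE ?oa ?ob ?ha ?hb eqxx.
Qed.

(** The arcs of a directed cycle are switchable: an output par keeps only its output premise, and at
    any other switched node all premises are inputs, which leave the node once reversed, while a
    cycle leaves a node only once. A leaf is then impossible, as its end is shared with the
    successor or the predecessor. *)
Lemma switching_acyclic_dacyclic : switching_acyclic G -> dacyclic (io_graph inp).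
Proof.
move=> acy x p /dcycle_circuit[C [C0 Csucc Cpred Cinj]].
have /existsP[_ /existsP[z /leafP[/imsetP[a0 aC ->] az nl u]]] : has_leaf (val @: C).
  apply: acy.
    by have /set0Pn[a aC] := C0; apply/set0Pn; exists (val a); apply: imset_f.
  move=> _ _ /imsetP[a aC ->] /imsetP[b bC ->] e sn.
  have [po|npo] := boolP (par_out inp (head (val a))).
    apply: (par_out_premise po) => //.
      by have := valP a; rewrite /= po.
    by have := valP b; rewrite /= -e po.
  have /forall_inP ai : all_in inp (premises (head (val a))).
    case/orP: (sn) => [/eqP/par_not_out/(_ npo)/andP[] //|/andP[/eqP ln _]].
    by have := polP (head (val a)); rewrite /polarized_node ln => /andP[].
  congr val; apply: Cinj => //=.
  by rewrite !ai // inE // e.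
pose a : arc (io_graph inp) := a0; rewrite -/a in aC az nl u.
have inc (c : arc (io_graph inp)) : incident (val c) (tail c) /\ incident (val c) (head c).
  by rewrite /incident /=; case: (inp _); rewrite !eqxx ?orbT.
have loop : tail a <> head a.
  by move=> /= e; case/eqP: nl; move: e; case: (inp _).
have /orP[/eqP e|/eqP e] : (z == head a) || (z == tail a).
- by move: az; rewrite /incident /=; case: (inp _); rewrite !(eq_sym z) // orbC.
- have [b bC eb] := Csucc a aC; apply: loop; rewrite -eb; congr tail.
  by apply/esym/val_inj/u; rewrite ?imset_f // e -eb; apply: (inc b).1.
- have [b bC eb] := Cpred a aC; apply: loop; rewrite -eb; congr head.
  by apply/val_inj/u; rewrite ?imset_f // e -eb; apply: (inc b).2.
Qed.

End Polarity.

Lemma ACC_w_ACC_io (R : pre_structure) (pol : polarity R) :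
  polarized pol -> ACC_w R -> ACC_io pol.
Proof.
elim: R pol => G b IH [inp pol] /= [pG pb] [aG ab]; split; last first.
  by move=> n hn; apply: IH => //; [apply: pb | apply: ab].
have [sacy bal] := (ACC_w_groundE G).1 aG.
by apply/(ACC_io_groundE pG); split=> //; apply: switching_acyclic_dacyclic.
Qed.

(** * Restriction to a set of nodes *)

Lemma sub_total_order (T U : finType) (f : T -> U) (A : {set T}) (B : {set U}) (r : rel U) :
  injective f -> f @: A \subset B -> total_order_on B r ->
  total_order_on A (fun x y => r (f x) (f y)).
Proof.
move=> fI /subsetP AB [an tr tot]; have fB x : x \in A -> f x \in B.
  by move=> xA; apply/AB/imset_f.
split=> [x y xA yA h|x y z xA yA zA|x y xA yA].
- by apply: fI; apply: an; rewrite ?fB.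
- by apply: tr; apply: fB.
- by apply: tot; apply: fB.
Qed.

Section Restriction.
Variables (G : ground) (n : node G) (T : {set node G}).
Hypothesis T_head : forall a : arc G, tail a \in T -> head a \in T \/ head a = n.
Hypothesis T_tail : forall a : arc G, head a \in T -> tail a \in T.
Hypothesis nT : n \notin T.

(* The premises of [n] with a tail in [T]: in the restriction of [G] to [T],
   each of them leads to a bullet of its own. *)
Definition cut_arc : pred (arc G) := [pred a | (tail a \in T) && (head a == n)].

Definition res_node : finType := ({m | m \in T} + {a | cut_arc a})%type.
Definition res_arc : finType := {a : arc G | tail a \in T}.

Definition res_tail (a : res_arc) : res_node := inl (Sub (tail (val a)) (valP a)).

(* The last branch is never reached. *)
Definition res_head (a : res_arc) : res_node :=
  if insub (head (val a)) is Some m then inl m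
  else if insub (val a) is Some c then inr c else res_tail a.

Definition res_graph : graph := Graph res_tail res_head.

Definition res_lab (m : node res_graph) : label :=
  match m with inl k => lab (val k) | inr _ => Bullet end.

(** The new bullets all go to [n], as [embedding] demands of removed bullets. *)
Definition res_fn (m : node res_graph) : node G :=
  match m with inl k => val k | inr _ => n end.

Definition res_bullets : {set node res_graph} :=
  [set m | if m is inr _ then true else false].

Implicit Types (a : arc res_graph) (k : {m | m \in T}) (c : {a | cut_arc a}).

Lemma res_headE a :
  (exists2 k, head a = inl k & val k = head (val a)) \/
  (exists2 c, head a = inr c & val c = val a).
Proof.
rewrite /= /res_head; case: insubP => [k _ ek|hT]; first by left; exists k.
right; have ca : cut_arc (val a).
  apply/andP; split; first exact: (valP a).
  by case: (T_head (valP a)) hT => [-> //|-> _].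
by rewrite (insubT _ ca); exists (Sub (val a) ca); rewrite ?SubK.
Qed.

Lemma cut_arc_head c : head (val c) = n.
Proof. by have /andP[_ /eqP] := valP c. Qed.

Lemma res_fn_head a : res_fn (head a) = head (val a).
Proof. by case: (res_headE a) => -[k -> //= <-]; rewrite cut_arc_head. Qed.

Lemma res_head_inl a k : (head a == inl k) = (head (val a) == val k).
Proof.
case: (res_headE a) => -[k' -> e]; rewrite -?e.
  by apply/eqP/eqP => [[->] //|/val_inj ->].
rewrite cut_arc_head; apply/esym/negbTE; apply: contra nT => /eqP ->.
exact: (valP k).
Qed.

Lemma res_head_inr a c : (head a == inr c) = (val a == val c).
Proof.
case: (res_headE a) => -[k' -> e].
  apply/esym/negbTE/eqP => ea; have := valP k'.
  by rewrite e ea cut_arc_head (negPf nT).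
by rewrite -e; apply/eqP/eqP => [[->] //|/val_inj ->].
Qed.

Lemma val_premises k : val @: premises (inl k : node res_graph) = premises (val k).
Proof.
apply/setP => a; rewrite inE; apply/imsetP/eqP => [[a' + ->]|ha].
  by rewrite inE res_head_inl => /eqP.
have ta : tail a \in T by apply: T_tail; rewrite ha (valP k).
by exists (Sub a ta); rewrite ?SubK // inE res_head_inl SubK ha.
Qed.

Lemma val_conclusions k : val @: conclusions (inl k : node res_graph) = conclusions (val k).
Proof.
apply/setP => a; rewrite inE; apply/imsetP/eqP => [[a' + ->]|ha].
  by rewrite inE => /eqP[<-].
have ta : tail a \in T by rewrite ha (valP k).
exists (Sub a ta : arc res_graph); rewrite ?SubK // inE; apply/eqP; congr inl.
exact: val_inj.
Qed.

Lemma res_prem_arity (m : node res_graph) : prem_arity (res_lab m) #|premises m|.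
Proof.
case: m => [k|c]; first by rewrite -(card_imset _ val_inj) val_premises; apply: prem_arityP.
have /andP[tc _] := valP c; apply/cards1P; exists (Sub (val c) tc : arc res_graph).
by apply/setP => a; rewrite !inE res_head_inr -val_eqE SubK.
Qed.

Lemma res_concl_arity (m : node res_graph) : concl_arity (res_lab m) #|conclusions m|.
Proof.
case: m => [k|c]; first by rewrite -(card_imset _ val_inj) val_conclusions; apply: concl_arityP.
by rewrite /= cards_eq0; apply/eqP/setP => a; rewrite !inE.
Qed.

(** Supplies an arbitrary order on the conclusions of a restriction, as [embedding] ignores that
    order. *)
Lemma enum_rank_total (U : finType) (A : {set U}) :
  total_order_on A (fun x y => enum_rank x <= enum_rank y).
Proof.
split=> [x y _ _ h|x y z _ _ _|x y _ _]; last exact: leq_total.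
  by apply/enum_rank_inj/val_inj/anti_leq.
exact: leq_trans.
Qed.

Lemma res_bang_total (m : node res_graph) : res_lab m = Bang ->
  total_order_on (conclusions m) (fun a b : arc res_graph => bang_le (val a) (val b)).
Proof.
case: m => // k lk; apply: sub_total_order val_inj _ (bang_leP lk).
by rewrite val_conclusions.
Qed.

Lemma res_mult_total (m : node res_graph) : res_lab m = Tens \/ res_lab m = Par ->
  total_order_on (premises m) (fun a b : arc res_graph => mult_le (val a) (val b)).
Proof.
case: m => [k lk|c []] //; apply: sub_total_order val_inj _ (mult_leP lk).
by rewrite val_premises.
Qed.

Definition res_ground : ground :=
  @Ground res_graph res_lab res_prem_arity res_concl_arity
    _ (enum_rank_total (struct_conclusions res_lab))
    _ res_bang_total _ res_mult_total.

Section Polarized.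
Variable inp : pred (arc G).

Definition res_inp : pred (arc res_ground) := [pred a | inp (val a)].

Lemma res_num_in (A : {set arc res_ground}) : num_in res_inp A = num_in inp (val @: A).
Proof.
rewrite /num_in -(card_imset _ val_inj); apply: eq_card => a; rewrite inE.
apply/imsetP/andP => [[b + ->]|[/imsetP[b bA ->] ib]]; last by exists b; rewrite ?inE ?bA.
by rewrite inE => /andP[bA ib]; rewrite imset_f.
Qed.

Lemma res_num_out (A : {set arc res_ground}) : num_out res_inp A = num_out inp (val @: A).
Proof.
by apply: (@addnI (num_in res_inp A)); rewrite {2}res_num_in !num_in_out card_imset //;
  apply: val_inj.
Qed.

Lemma res_all (P : pred (arc G)) (A : {set arc res_ground}) :
  [forall a in A, P (val a)] = [forall a in val @: A, P a].
Proof.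
apply/forall_inP/forall_inP => h; last by move=> a aA; apply/h/imset_f.
by move=> _ /imsetP[a aA ->]; apply: h.
Qed.

Lemma res_all_in (A : {set arc res_ground}) : all_in res_inp A = all_in inp (val @: A).
Proof. exact: res_all. Qed.

Lemma res_all_out (A : {set arc res_ground}) : all_out res_inp A = all_out inp (val @: A).
Proof. exact: (res_all (fun a : arc G => ~~ inp a)). Qed.

Lemma res_principal (a : arc res_ground) : principal a = principal (val a).
Proof.
rewrite /principal; congr (_ && _).
rewrite (res_all (fun b : arc G => bang_le b (val a))) val_conclusions.
by [].
Qed.

Lemma res_polarized : polarized_ground inp -> polarized_ground res_inp.
Proof.
move=> pol [k|c] //; have := pol (val k).
rewrite /polarized_node /= !res_num_in !res_num_out !res_all_in !res_all_out.
rewrite val_premises val_conclusions; case: (lab _) => //.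
rewrite -val_conclusions -res_all => /forall_inP h; apply/forall_inP => a aC.
by rewrite res_principal; apply: h.
Qed.

Lemma res_par_out_inl k : par_out res_inp (inl k) = par_out inp (val k).
Proof. by rewrite /par_out /= res_all_out val_conclusions. Qed.

Lemma res_par_out_terminal :
  par_out_terminal_ground inp -> par_out_terminal_ground res_inp.
Proof.
move=> tm a; have -> : par_out res_inp (tail a) = par_out inp (tail (val a)).
  exact: (res_par_out_inl (Sub (tail (val a)) (valP a))).
move/tm.
by case: (res_headE a) => -[k' -> e]; [rewrite res_par_out_inl -e | right].
Qed.

Lemma res_dacyclic : dacyclic (io_graph inp) -> dacyclic (io_graph res_inp).
Proof.
move=> /dacyclic_rank[rho rhoP].
(* New bullets have no other arc, so they can be put first or last. *)
pose rho' (m : node res_ground) : nat :=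
  match m with
  | inl k => (rho (val k)).+1
  | inr c => if inp (val c) then 0 else (rho (tail (val c))).+2
  end.
apply: (@rank_dacyclic (io_graph res_inp) rho') => -[a live] /=.
case: (res_headE a) => -[k' ea e]; move: live; rewrite /= in ea; rewrite /= ea /res_inp /=.
  rewrite res_par_out_inl e => live; have := rhoP (Sub (val a) live); rewrite /=.
  by rewrite /= in e; case: (inp _) => /=; rewrite -e.
by move=> _; rewrite /= in e; case ic: (inp _) => /=; rewrite e ic.
Qed.

End Polarized.
End Restriction.

Lemma well_formedE (R : pre_structure) : well_formed R <->
  forall (n : node R) (hn : lab n == Bang),
    #|struct_conclusions (@lab (box R n hn))| = #|conclusions n| /\ well_formed (box R n hn).
Proof. by case: R. Qed.

Section RestrictedStructure.
Variables (G : ground) (b : forall n : node G, lab n == Bang -> pre_structure).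
Let R := Pre b.
Variables (n : node G) (T : {set node G}).
Hypothesis T_head : forall a : arc G, tail a \in T -> head a \in T \/ head a = n.
Hypothesis T_tail : forall a : arc G, head a \in T -> tail a \in T.
Hypothesis nT : n \notin T.
Let H := res_ground T_head T_tail nT.

Definition res_box (m : node H) : lab m == Bang -> pre_structure :=
  match m return @lab H m == Bang -> pre_structure with
  | inl k => fun h => @b (val k) h
  | inr _ => fun h => False_rect _ (notF h)
  end.

Definition res_pre : pre_structure := Pre res_box.

Lemma res_wf : well_formed R -> well_formed res_pre.
Proof.
move=> /well_formedE wf; apply/well_formedE => -[k|c] //= hk.
have [wk wbk] := wf (val k) hk; split=> //.
by rewrite wk -(val_conclusions n k) (card_imset _ val_inj).
Qed.

Section Polarity.
Variables (inp : pred (arc G)) (polb : forall (m : node G) (hm : lab m == Bang), polarity (b hm)).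

Definition res_polb (m : node H) : forall hm : lab m == Bang, polarity (res_box hm) :=
  match m return forall hm : @lab H m == Bang, polarity (@res_box m hm) with
  | inl k => fun h => @polb (val k) h
  | inr _ => fun h => False_rect _ (notF h)
  end.

Definition res_pol : polarity res_pre := (@res_inp G n T T_head T_tail nT inp, res_polb).

Lemma res_pol_hereditarily (P : forall G' : ground, pred (arc G') -> Prop) :
  P H res_pol.1 -> (forall m (hm : lab m == Bang), pol_hereditarily P (polb hm)) ->
  pol_hereditarily P res_pol.
Proof. by move=> PH Pb; split=> // -[k|c] h //; apply: Pb. Qed.

End Polarity.

(** [S] is a variable with an equation because a binary gluing gives the removed bullets as a
    singleton. *)
Lemma res_embedding (S : {set node res_pre}) : S = res_bullets n T ->
  @embedding R n res_pre S (@res_fn G n T) val.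
Proof.
move=> ->; split.
- by case=> // k; rewrite inE.
- case=> [k|c]; rewrite inE //=; split=> // e.
  by case/negP: nT; rewrite -e; apply: (valP k).
- move=> [k|c] [k'|c']; rewrite !inE //= => _ _ /val_inj -> //.
- exact: val_inj.
- by [].
- by move=> a; rewrite (res_fn_head T_head).
- by case=> [k|c]; rewrite !inE.
- by [].
- by [].
- case=> [k|c] h h' //=.
  by rewrite (eq_irrelevance h' h).
Qed.

End RestrictedStructure.

Section Complement.
Variables (G : ground) (b : forall n : node G, lab n == Bang -> pre_structure).
Let R := Pre b.
Variables (n : node R) (T1 : {set node R}).
Hypothesis term : terminal n.
Hypothesis nl : lab n <> Bullet.
Hypothesis T1_head : forall a : arc G, tail a \in T1 -> head a \in T1 \/ head a = n.
Hypothesis T1_tail : forall a : arc G, head a \in T1 -> tail a \in T1.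
Hypothesis nT1 : n \notin T1.

(** The second part of a binary gluing whose first part is [T1]; with [T1] empty, the only part of a
    unary one. *)
Definition rest : {set node G} :=
  [set m | [&& m \notin T1, m != n & [forall a, (tail a == n) ==> (head a != m)]]].

Lemma restP m : reflect [/\ m \notin T1, m <> n & ~ below n m] (m \in rest).
Proof.
rewrite inE; apply: (iffP and3P) => -[m1 /eqP mn bel]; split=> //; try exact/eqP.
  by move=> [a [ta ha]]; have /forallP/(_ a) := bel; rewrite ta ha !eqxx.
by apply/forallP => a; apply/implyP => /eqP ta; apply/eqP => ha; apply: bel; exists a.
Qed.

Lemma below_notin m : below n m -> m \notin T1.
Proof. by move=> [a [ta <-]]; apply: contra nT1 => /T1_tail; rewrite ta. Qed.

Lemma node_cover m : m <> n /\ ~ below n m <-> m \in T1 \/ m \in rest.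
Proof.
split=> [[mn bel]|[m1|/restP[] //]].
  by have [|m1] := boolP (m \in T1); [left | right; apply/restP].
split; first by move=> e; move: nT1; rewrite -e m1.
by move/below_notin; rewrite m1.
Qed.

Lemma arc_cover (a : arc G) : tail a <> n <-> tail a \in T1 \/ tail a \in rest.
Proof.
rewrite -node_cover; split=> [tn|[]//]; split=> // -[c [tc hc]].
by apply: (@bullet_tail G a); rewrite -hc; apply: term.
Qed.

Lemma rest_head a : tail a \in rest -> head a \in rest \/ head a = n.
Proof.
move=> /restP[t1 tn tb]; have [|/eqP hn] := eqVneq (head a) n; [by right | left].
apply/restP; split=> // [|[c [tc hc]]]; first by apply: contra t1 => /T1_tail.
(* A bullet below [n] has a single premise, a conclusion of [n], so [a] cannot enter it. *)
have hb : lab (head a) = Bullet by rewrite -hc; apply: term.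
have [d _ u] := bullet_premise hb.
by apply: tn; rewrite (u a erefl) -(u c hc).
Qed.

Lemma rest_tail a : head a \in rest -> tail a \in rest.
Proof.
move=> /restP[h1 hn hb]; apply/restP; split.
- by apply/negP => /T1_head[]; [apply/negP | ].
- by move=> ta; apply: hb; exists a.
by move=> [c [tc hc]]; apply: (@bullet_tail G a); rewrite -hc; apply: term.
Qed.

Lemma rest_n : n \notin rest.
Proof. by apply/restP => -[]. Qed.

End Complement.

(** * Sequentialization *)

(** Quantified over [wf] because the induction is on pre-structures while [sequential] speaks of
    proof-structures. *)
Definition sequentializable (R : pre_structure) : Prop :=
  forall (wf : well_formed R) (pol : polarity R),
    polarized pol -> par_out_terminal pol -> ACC_io pol -> sequential (ProofStructure wf).

Section Sequentialization.
Variables (G : ground) (b : forall n : node G, lab n == Bang -> pre_structure).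
Let R := Pre b.
Hypothesis wf : well_formed R.
Variables (inp : pred (arc G)) (polb : forall (m : node G) (hm : lab m == Bang), polarity (b hm)).
Hypotheses (pol : @polarized R (inp, polb)) (tm : @par_out_terminal R (inp, polb)).
Hypothesis acc : @ACC_io R (inp, polb).
Hypothesis IHbox : forall m (hm : lab m == Bang), sequentializable (b hm).
Hypothesis IHarc : forall (G' : ground) (b' : forall n : node G', lab n == Bang -> pre_structure),
  #|arc G'| < #|arc G| -> (forall m (hm : lab m == Bang), sequentializable (b' m hm)) ->
  sequentializable (Pre b').

Let polG : polarized_ground inp := pol.1.
Let dacG : dacyclic (io_graph inp) := ((ACC_io_groundE polG).1 acc.1).1.
Let balG : balanced G := ((ACC_io_groundE polG).1 acc.1).2.

Section Restricted.
Variables (n : node G) (T : {set node G}).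
Hypothesis T_head : forall a : arc G, tail a \in T -> head a \in T \/ head a = n.
Hypothesis T_tail : forall a : arc G, head a \in T -> tail a \in T.
Hypothesis nT : n \notin T.

(** Polarization, terminality and directed acyclicity pass to any restriction, and a missing arc
    makes the induction hypothesis applicable. Only the count is global, so balance has to be
    supplied. *)
Lemma res_sequential : (exists a : arc G, tail a \notin T) ->
  balanced (res_ground T_head T_tail nT) ->
  sequential (ProofStructure (@res_wf G b _ _ T_head T_tail nT wf)).
Proof.
move=> [a aT] bal; pose pol' := @res_pol G b n T T_head T_tail nT inp polb.
apply: (@IHarc (res_ground T_head T_tail nT) _ _ _ _ pol').
- rewrite card_sig -cardsE; apply: proper_card; apply/properP; split; first exact/subsetP.
  by exists a; rewrite // inE.
- by case=> // k hk; apply: IHbox.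
- by apply: res_pol_hereditarily => [|m hm]; [apply: res_polarized | apply: pol.2].
- by apply: res_pol_hereditarily => [|m hm];
    [apply: res_par_out_terminal; apply: tm.1 | apply: tm.2].
- apply: res_pol_hereditarily => [|m hm]; last exact: acc.2.
  by apply/ACC_io_groundE; [apply: res_polarized | split=> //; apply: res_dacyclic].
Qed.

End Restricted.

Lemma unary_sequential (n : node R) :
  [\/ lab n = Bot, lab n = Par, lab n = Der | lab n = Why] -> terminal n ->
  sequential (ProofStructure wf).
Proof.
move=> ln term; have nl : lab n <> Bullet by case: ln => ->.
have [c tc _] : exists2 c : arc G, tail c = n & forall d : arc G, tail d = n -> d = c.
  by apply: single_conclusion; case: ln => ->.
pose T := rest n set0.
have h0 (a : arc G) : tail a \in set0 -> head a \in set0 \/ head a = n by rewrite inE.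
have t0 (a : arc G) : head a \in set0 -> tail a \in set0 by rewrite !inE.
have n0 : n \notin set0 by rewrite inE.
pose Th := rest_head term t0; pose Tt := rest_tail term h0; pose nT := rest_n n set0.
have aT (a : arc G) : tail a <> n <-> tail a \in T.
  by rewrite (arc_cover term t0 n0) inE; split; [case | right].
have ext : @unary_extension R n (res_pre b Th Tt nT) (res_bullets n T).
  split=> //; exists (@res_fn G n T), val; split; first exact: res_embedding.
    move=> a; rewrite aT; split=> [ta|[a1 <-]]; last exact: (valP a1).
    by exists (Sub a ta).
  move=> m; rewrite (node_cover t0 n0); split=> [[|mT]|[[k|k'] h <-]].
  - by rewrite inE.
  - by exists (inl (Sub m mT)); rewrite ?inE.
  - by right; apply: (valP k).
  - by rewrite inE in h.
apply: (@Sequential (ProofStructure wf) n).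
apply: (@SeqUnary (ProofStructure wf) (ProofStructure (@res_wf G b _ _ Th Tt nT wf)) n _ ln _ ext).
  rewrite (_ : #|_| = #|premises n|); first exact: prem_arityP.
  have inr_inj : injective (inr : {a | cut_arc n T a} -> node (res_graph n T)) by move=> x y [].
  transitivity #|inr @: [set: {a | cut_arc n T a}] : {set node (res_graph n T)}|.
    apply: eq_card => -[k|c']; rewrite !inE; last by rewrite imset_f.
    by apply/esym/negbTE/imsetP => -[].
  rewrite card_imset // cardsT card_sig -cardsE; apply: eq_card => a; rewrite in_set [RHS]inE.
  rewrite [LHS]inE /cut_arc /=; have [ha|] := eqVneq (head a) n; last by rewrite andbF.
  rewrite andbT; apply/aT => ta.
  by apply: nl; rewrite -ha; apply: (term a ta).
apply: res_sequential; first by exists c; rewrite tc; apply: nT.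
(* [n] neither produces nor consumes, so balance goes back from [R] to the part. *)
have := balG; rewrite /balanced (@unary_count R n term _ _ ext produces) //.
rewrite (@unary_count R n term _ _ ext consumes) //.
by case: ln => ->.
Qed.

(** [e1] being the only arc from [T1] to [n], the other premise [e2] comes from the remaining nodes.
    These are balanced by subtraction, since [n] counts as one consumer. *)
Lemma binary_sequential (n : node R) (T1 : {set node G}) (e1 : arc G)
    (T1_head : forall a : arc G, tail a \in T1 -> head a \in T1 \/ head a = n)
    (T1_tail : forall a : arc G, head a \in T1 -> tail a \in T1) (nT1 : n \notin T1) :
  lab n = Cut \/ lab n = Tens -> terminal n ->
  (forall a, cut_arc n T1 a <-> a = e1) ->
  balanced (res_ground T1_head T1_tail nT1) ->
  sequential (ProofStructure wf).
Proof.
move=> ln term cutP bal1; have nl : lab n <> Bullet by case: ln => ->.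
pose T2 := rest n T1.
pose T2_head := rest_head term T1_tail; pose T2_tail := rest_tail term T1_head.
pose nT2 := rest_n n T1.
have aT := arc_cover term T1_tail nT1.
have [e1T he1] : tail e1 \in T1 /\ head e1 = n.
  by have /andP[? /eqP ?] := (cutP e1).2 erefl.
have T12 m : m \in T1 -> m \notin T2 by move=> mT; rewrite inE mT.
have [e2 [e2T he2 e2u]] : exists e2 : arc G, [/\ tail e2 \in T2, head e2 = n &
    forall a : arc G, tail a \in T2 -> head a = n -> a = e2].
  have : #|premises n :\ e1| == 1.
    have := prem_arityP n; rewrite (cardsD1 e1) inE he1 eqxx.
    by case: ln => -> /eqP; rewrite add1n => -[->].
  case/cards1P => e2 ee; have := set11 e2; rewrite -ee !inE => /andP[ne /eqP he2].
  exists e2; split=> //.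
    have [|t1|//] := (aT e2).1; first by move=> ta; apply: nl; rewrite -he2; apply: (term e2 ta).
    by case/eqP: ne; apply/cutP/andP; rewrite he2 eqxx.
  move=> a ta ha; apply/eqP; rewrite -in_set1 -ee !inE ha eqxx andbT.
  by apply: contraTneq ta => ->; apply: T12.
have c1 : cut_arc n T1 e1 by apply/cutP.
have c2 : cut_arc n T2 e2 by apply/andP; rewrite he2 eqxx.
pose b1 : node (res_pre b T1_head T1_tail nT1) := inr (Sub e1 c1).
pose b2 : node (res_pre b T2_head T2_tail nT2) := inr (Sub e2 c2).
have B1 : [set b1] = res_bullets n T1.
  apply/setP => -[k|c]; rewrite !inE //; apply/eqP; congr inr; apply: val_inj.
  by apply/cutP; apply: (valP c).
have B2 : [set b2] = res_bullets n T2.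
  apply/setP => -[k|c]; rewrite !inE //; apply/eqP; congr inr; apply: val_inj.
  by have /andP[tc /eqP hc] := valP c; apply: e2u.
have ext : @binary_extension R n _ _ b1 b2.
  split=> //; exists (@res_fn G n T1), val, (@res_fn G n T2), val; split.
  - by split; apply: res_embedding.
  - by move=> a1 a2 e; have := valP a2; rewrite -e (negPf (T12 _ (valP a1))).
  - move=> [k1|c] [k2|c'] h1 h2 //= e.
    + by case/negP: (T12 _ (valP k1)); rewrite [val k1]e; apply: (valP k2).
    + by case/negP: (nT1); rewrite -e; apply: (valP k1).
    + by have : sval k2 \in T2 := valP k2; rewrite -e (negPf nT2).
    by have := set11 b1; rewrite B1; move: h1; rewrite -in_set1 B1 inE.
  - move=> a; rewrite aT; split=> [[t1|t2]|[[a1 <-]|[a2 <-]]].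
    + by left; exists (Sub a t1).
    + by right; exists (Sub a t2).
    + by left; apply: (valP a1).
    + by right; apply: (valP a2).
  move=> m; rewrite (node_cover T1_tail nT1); split=> [[m1|m2]|].
  - by left; exists (inl (Sub m m1)).
  - by right; exists (inl (Sub m m2)).
  case=> [[[k|c] h <-]|[[k|c] h <-]].
  - by left; apply: (valP k).
  - by move: h; rewrite -in_set1 B1 inE.
  - by right; apply: (valP k).
  - by move: h; rewrite -in_set1 B2 inE.
apply: (@Sequential (ProofStructure wf) n).
apply: (@SeqBinary (ProofStructure wf)
  (ProofStructure (@res_wf G b _ _ T1_head T1_tail nT1 wf))
  (ProofStructure (@res_wf G b _ _ T2_head T2_tail nT2 wf)) n b1 b2 ln ext).
  by apply: res_sequential => //; exists e2; apply/negP => /T12; rewrite e2T.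
apply: res_sequential; first by exists e1; apply: T12.
have := balG; rewrite /balanced (@binary_count R n term _ _ _ _ ext produces) //.
rewrite (@binary_count R n term _ _ _ _ ext consumes) //.
move: bal1; rewrite /balanced.
by case: ln => ->; rewrite /produces /consumes !inE /=; lia.
Qed.

Lemma alone_sequential :
  (forall m : node G, [\/ produces (lab m) | lab m = Bullet]) ->
  sequential (ProofStructure wf).
Proof.
move=> labs; have no_consumer : [set m : node G | consumes (lab m)] = set0.
  apply/setP => m; rewrite !inE; case: (labs m) => [|-> //].
  by case: (lab m).
(* Without consumers, balance leaves exactly one producer, which is then the tail of every arc. *)
have := balG; rewrite /balanced no_consumer cards0 add0n => /eqP/cards1P[n en].
have nP m : produces (lab m) -> m = n.
  by move=> pm; apply/eqP; rewrite -in_set1 -en inE.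
have ln : produces (lab n) by have := set11 n; rewrite -en inE.
have ta (a : arc G) : tail a = n.
  by apply: nP; case: (labs (tail a)) => // /bullet_tail.
have al : @alone R n.
  split=> // m mn; have lm : lab m = Bullet by case: (labs m) => // /nP.
  by split=> //; have [a ha _] := bullet_premise lm; exists a.
apply: (@Sequential (ProofStructure wf) n).
have [/eqP hn|nb] := boolP (lab n == Bang); last first.
  by apply: SeqAxiom => //; move: ln nb; rewrite /produces !inE; case: (lab n); auto.
move/eqP: (hn) => hb; have [_ wfb] := (well_formedE R).1 wf n hb.
apply: (@SeqBang (ProofStructure wf) (ProofStructure wfb) n hb) => //.
by apply: (IHbox (hm := hb)) (pol.2 n hb) (tm.2 n hb) (acc.2 n hb).
Qed.

End Sequentialization.

(** * Finding a splitting node *)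

Definition terminalb (G : ground) (n : node G) : bool :=
  [forall a in conclusions n, lab (head a) == Bullet].

Lemma terminalP (G : ground) (b : forall n : node G, lab n == Bang -> pre_structure) (n : node G) :
  reflect (@terminal (Pre b) n) (terminalb n).
Proof.
apply: (iffP forall_inP) => [h a ta|h a]; first by apply/eqP/h; rewrite inE; apply/eqP.
by rewrite inE => /eqP ta; apply/eqP/h.
Qed.

Section Splitting.
Variables (G : ground) (inp : pred (arc G)).
Hypothesis polG : polarized_ground inp.
Hypothesis tmG : par_out_terminal_ground inp.
Hypothesis dacG : dacyclic (io_graph inp).
Hypothesis no_unary : forall n : node G, lab n \in [:: Bot; Par; Der; Why] -> ~~ terminalb n.
Implicit Types (n m x y : node G) (a c e : arc G).

Lemma nonterminal_conclusion n : ~~ terminalb n -> lab n \in [:: Tens; Bot; Par; Der; Why] ->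
  exists2 c, tail c = n & lab (head c) <> Bullet.
Proof.
by move=> /forall_inPn[c]; rewrite inE => /eqP tc /eqP hc _; exists c.
Qed.

Lemma io_rank_live : exists rho : node G -> nat, forall a,
  ~~ (par_out inp (head a) && inp a) ->
  rho (if inp a then head a else tail a) < rho (if inp a then tail a else head a).
Proof.
have [rho rhoP] := dacyclic_rank dacG.
by exists rho => a live; exact: (rhoP (Sub a live)).
Qed.

Lemma no_par_out n : ~~ par_out inp n.
Proof.
have [rho rhoP] := io_rank_live.
apply/negP => po; have [m pm mmax] := @arg_maxnP _ n (par_out inp) rho po.
have /andP[/eqP lm /forall_inP ao] := pm.
have [||c tc hc] := @nonterminal_conclusion m; [by rewrite no_unary ?lm | by rewrite lm | ].
have oc : ~~ inp c by apply: ao; rewrite inE tc.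
have [|ph|//] := @tmG c; first by rewrite tc.
have := rhoP c; rewrite (negPf oc) andbF tc => /(_ isT).
by have := mmax _ ph; rewrite /=; lia.
Qed.

Lemma io_rank : exists2 rho : node G -> nat,
  forall a, inp a -> rho (head a) < rho (tail a) &
  forall a, ~~ inp a -> rho (tail a) < rho (head a).
Proof.
have [rho rhoP] := io_rank_live.
by exists rho => a ia; have := rhoP a; rewrite (negPf (no_par_out _)) ?ia ?(negPf ia) => /(_ isT).
Qed.

Lemma negative_conclusion n c : lab n \in [:: Bot; Par; Der; Why] -> tail c = n -> inp c.
Proof.
move=> ln tc; have /forall_inP : all_in inp (conclusions n); last by apply; rewrite inE tc.
have := polG n; rewrite /polarized_node; move: ln; rewrite !inE.
case ln: (lab n) => //= _ => [|/andP[]//].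
by have /andP[] := par_not_out polG ln (no_par_out n).
Qed.

(** Candidates for splitting: for one of least rank, the head is the node to remove and the
    ancestors of the tail are the part to detach. *)
Definition fork e : bool :=
  [&& ~~ inp e, lab (head e) \in [:: Cut; Tens] & terminalb (head e)].

Lemma terminalb_cut n : lab n = Cut -> terminalb n.
Proof.
move=> ln; apply/forall_inP => a aC; have := concl_arityP n.
by rewrite ln => /eqP/cards0_eq e; rewrite e inE in aC.
Qed.

Lemma output_premise n : lab n \in [:: Cut; Tens] -> exists2 e, head e = n & ~~ inp e.
Proof.
move=> ln; suff /card_gt0P[e] : 0 < num_out inp (premises n).
  by rewrite !inE => /andP[/eqP he oe]; exists e.
have := num_in_out inp (premises n); have := prem_arityP n; have := polG n.
rewrite /polarized_node; move: ln; rewrite !inE; case: (lab n) => //= _.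
  by case/andP => _ /eqP ->.
case/orP => [/andP[/num_out_all_out -> _] /eqP -> //|/andP[/eqP -> _] /eqP ->].
by lia.
Qed.

Section Rank.
Variable rho : node G -> nat.
Hypothesis rho_in : forall a, inp a -> rho (head a) < rho (tail a).
Hypothesis rho_out : forall a, ~~ inp a -> rho (tail a) < rho (head a).

(** Follow input arcs downwards, along which [rho] decreases. At a cut or terminal tensor, an output
    premise is a fork with a tail of still lower rank. Any other node reached has an input
    conclusion that is not above a bullet, so the descent continues. *)
Lemma fork_below a : inp a -> lab (head a) <> Bullet ->
  exists2 e, fork e & rho (tail e) < rho (head a).
Proof.
have [k] := ubnP (rho (head a)); elim: k a => // k IH a ka ia hb.
have [lf|nlf] := boolP ((lab (head a) \in [:: Cut; Tens]) && terminalb (head a)).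
  have /andP[lh th] := lf; have [e he oe] := output_premise lh.
  by exists e; [rewrite /fork oe he lf | rewrite -he rho_out].
have [c [tc hc ic]] : exists c, [/\ tail c = head a, lab (head c) <> Bullet & inp c].
  have pa : 0 < #|premises (head a)| by apply/card_gt0P; exists a; rewrite inE.
  have [ln|ln] := boolP (lab (head a) \in [:: Bot; Par; Der; Why]).
    have [||c tc hc] := @nonterminal_conclusion (head a).
    - exact: no_unary.
    - by move: ln; rewrite !inE; case: (lab _).
    by exists c; split=> //; apply: negative_conclusion tc.
  have lt : lab (head a) = Tens.
    have tcut := @terminalb_cut (head a).
    move: ln nlf (prem_arityP (head a)) pa hb tcut; rewrite !inE.
    by case: (lab _) => //= _ + /eqP -> //; rewrite ?ltnn // => /negP nt _ _ /(_ erefl).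
  have [||c tc hc] := @nonterminal_conclusion (head a); rewrite ?lt //.
    by move: nlf; rewrite lt inE.
  (* As [a] is an input premise, the tensor is not purely output, so its conclusion is an input. *)
  exists c; split=> //; have := polG (head a); rewrite /polarized_node lt.
  case/orP => [/andP[/forall_inP ao _]|/andP[_ /forall_inP ai]].
    by have := ao a; rewrite inE eqxx ia => /(_ isT).
  by apply: ai; rewrite inE tc.
have hca : rho (head c) < rho (head a) by rewrite -tc rho_in.
have [|e fe re] := IH c _ ic hc; first by lia.
by exists e => //; lia.
Qed.

Variable e1 : arc G.
Hypothesis fork_e1 : fork e1.
Hypothesis e1_min : forall e, fork e -> rho (tail e1) <= rho (tail e).

(** One step in the i/o graph, from which nothing is erased here since there is no output par. *)
Definition io_step : rel (node G) := [rel x y | [exists a,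
  ((if inp a then head a else tail a) == x) && ((if inp a then tail a else head a) == y)]].

Definition ancestors : {set node G} := [set x | connect io_step x (tail e1)].

Let out_e1 : ~~ inp e1. Proof. by case/and3P: fork_e1. Qed.

Lemma rho_ancestor x : x \in ancestors -> rho x <= rho (tail e1).
Proof.
rewrite inE => /connectP[p]; elim: p x => [|y p IH] x /=; first by move=> _ ->.
case/andP => /existsP[a /andP[/eqP ax /eqP ay]] /IH h /h; apply: leq_trans.
by move: ax ay; case: ifPn => [/rho_in|/rho_out]; move=> + <- <-; apply: ltnW.
Qed.

Lemma ancestor_step x : x \in ancestors -> x = tail e1 \/
  exists b, [/\ ~~ inp b, tail b = x & head b \in ancestors] \/
            [/\ inp b, head b = x & tail b \in ancestors].
Proof.
rewrite inE => /connectP[[|y p] /=]; first by left.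
case/andP => /existsP[a /andP[ax ay]] py ey; right; exists a.
have yA : y \in ancestors by rewrite inE; apply/connectP; exists p.
by move: ax ay; case: ifPn => ia /eqP ax /eqP ay; [right | left]; rewrite ax ay.
Qed.

Lemma ancestor_out a : ~~ inp a -> head a \in ancestors -> tail a \in ancestors.
Proof.
rewrite !inE => ia; apply: connect_trans; apply/connect1/existsP; exists a.
by rewrite (negPf ia) !eqxx.
Qed.

Lemma ancestor_in a : inp a -> tail a \in ancestors -> head a \in ancestors.
Proof.
rewrite !inE => ia; apply: connect_trans; apply/connect1/existsP; exists a.
by rewrite ia !eqxx.
Qed.

(** Otherwise [fork_below] gives a fork whose tail ranks strictly below [head a], hence below
    [tail e1], against minimality. *)
Lemma ancestor_bullet a : inp a -> head a \in ancestors -> lab (head a) = Bullet.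
Proof.
move=> ia aA; have [/eqP //|/eqP hb] := boolP (lab (head a) == Bullet).
have [e /e1_min] := fork_below ia hb.
by have := rho_ancestor aA; lia.
Qed.

(** Having no conclusion, a bullet can reach [tail e1] only through its premise, traversed backwards
    as an input arc. *)
Lemma bullet_ancestor a : lab (head a) = Bullet -> head a \in ancestors ->
  inp a /\ tail a \in ancestors.
Proof.
move=> hb hA; have [e|[b [[ob tb _]|[ib hb' tA]]]] := ancestor_step hA.
- by have := @bullet_tail _ e1; rewrite -e hb.
- by have := @bullet_tail _ b; rewrite tb hb.
by have [c _ u] := bullet_premise hb; rewrite (u a) // -(u b).
Qed.

(** A node has at most one output conclusion, so an output arc leaving an ancestor is either [e1] or
    the arc by which that ancestor reaches [tail e1]. An ancestor that starts instead with an input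
    premise taken backwards would be a bullet, which has no conclusion. *)
Lemma ancestors_head a : tail a \in ancestors -> head a \in ancestors \/ a = e1.
Proof.
move=> tA; have [ia|oa] := boolP (inp a); first by left; apply: ancestor_in.
have [e|[b [[ob tb hA]|[ib hb _]]]] := ancestor_step tA.
- by right; apply: (output_inj polG).
- by left; rewrite (output_inj polG oa ob (esym tb)).
have := @bullet_tail _ a; rewrite -hb => nb; case: nb.
by apply: ancestor_bullet ib _; rewrite hb.
Qed.

Lemma ancestors_tail a : head a \in ancestors -> tail a \in ancestors.
Proof.
move=> hA; have [ia|oa] := boolP (inp a); last exact: ancestor_out.
exact: (bullet_ancestor (ancestor_bullet ia hA) hA).2.
Qed.

Lemma ancestors_fork : head e1 \notin ancestors.
Proof. by apply/negP => /rho_ancestor; have := rho_out out_e1; lia. Qed.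

Lemma ancestors_head_fork a : tail a \in ancestors -> head a \in ancestors \/ head a = head e1.
Proof. by move=> /ancestors_head[]; [left | move=> ->; right]. Qed.

Lemma ancestors_cut a : cut_arc (head e1) ancestors a <-> a = e1.
Proof.
split=> [/andP[/ancestors_head[hA|//] /eqP he]|->].
  by have := ancestors_fork; rewrite -he hA.
by apply/andP; rewrite inE connect0.
Qed.

(** Balance comes from the polarized count: the restriction has no classical ?d, since its input
    conclusion would enter an ancestor, hence a bullet, while no ?d is terminal; and its old bullets
    have input premises, so the only output bullet is the new one below [e1]. *)
Lemma ancestors_balanced :
  balanced (res_ground ancestors_head_fork ancestors_tail ancestors_fork).
Proof.
set H := res_ground _ _ _; pose inpH : pred (arc H) := @res_inp _ _ _ _ _ _ inp.
have polH : polarized_ground inpH by apply: res_polarized.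
apply: (proj2 (iffLR (ACC_io_groundE polH) _)); split.
  exact: res_dacyclic.
have -> : classical_ders inpH = set0.
  apply/setP => -[k|c]; rewrite !inE //=; apply/negbTE/negP => /andP[/eqP lk _].
  have [||c tc hc] := @nonterminal_conclusion (val k); [by rewrite no_unary ?lk | by rewrite lk | ].
  have ic : inp c by apply: negative_conclusion tc; rewrite lk.
  by apply/hc/(ancestor_bullet ic)/ancestor_in => //; rewrite tc; apply: (valP k).
have c1 : cut_arc (head e1) ancestors e1 by apply/ancestors_cut.
have -> : out_bullets inpH = [set (inr (Sub e1 c1) : node H)].
  apply/setP => -[k|c]; rewrite !inE /=.
    apply/negbTE/negP => /andP[/eqP lk].
    have [a ha _] := bullet_premise lk.
    have hA : head a \in ancestors by rewrite ha; apply: (valP k).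
    have hb : lab (head a) = Bullet by rewrite ha.
    have [ia tA] := bullet_ancestor hb hA.
    rewrite res_all_out (val_premises ancestors_head_fork ancestors_tail ancestors_fork k).
    by move/forall_inP/(_ a); rewrite inE ha eqxx ia => /(_ isT).
  have ec : val c = e1 by apply/ancestors_cut; apply: (valP c).
  apply/idP/eqP => [_|_]; first by congr inr; apply: val_inj.
  apply/forall_inP => a.
  rewrite inE (res_head_inr ancestors_head_fork ancestors_fork) ec => /eqP ea.
  suff : ~~ inp (val a) by []; by rewrite ea.
by rewrite cards0 cards1.
Qed.

End Rank.

(** Without forks, [fork_below] forces every input arc into a bullet. This excludes bot, par, ?d and
    ? nodes, none of which is terminal. A cut would give a fork, and the output conclusion of a
    tensor of highest rank would enter a higher tensor. *)
Lemma no_fork_label : (forall e, ~~ fork e) -> forall n,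
  [\/ produces (lab n) | lab n = Bullet].
Proof.
move=> nf; have [rho rho_in rho_out] := io_rank.
have inb a : inp a -> lab (head a) = Bullet.
  move=> ia; have [/eqP //|/eqP hb] := boolP (lab (head a) == Bullet).
  by have [e] := fork_below rho_in rho_out ia hb; rewrite (negPf (nf e)).
have nterm n : lab n \in [:: Cut; Tens] -> ~~ terminalb n.
  move=> ln; have [e he oe] := output_premise ln.
  by have := nf e; rewrite /fork oe he ln.
have nneg n : lab n \notin [:: Bot; Par; Der; Why].
  apply/negP => ln; have [||c tc] := @nonterminal_conclusion n; first exact: no_unary.
    by move: ln; rewrite !inE; case: (lab n).
  by apply; apply: inb; apply: negative_conclusion tc.
have ncut n : lab n <> Cut.
  by move=> ln; have := nterm n; rewrite (terminalb_cut ln) ln => /(_ isT).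
have ntens n : lab n <> Tens.
  move=> ln; have [m /eqP lm mmax] := @arg_maxnP _ n (fun m => lab m == Tens) rho (introT eqP ln).
  have [||c tc hc] := @nonterminal_conclusion m; [by rewrite nterm ?lm | by rewrite lm | ].
  have oc : ~~ inp c by apply/negP => /inb.
  have ht : lab (head c) = Tens.
    have pc : 0 < #|premises (head c)| by apply/card_gt0P; exists c; rewrite inE.
    have nc := ncut (head c); move: (nneg (head c)) (prem_arityP (head c)) pc hc nc.
    by rewrite !inE; case: (lab _) => //= _ /eqP ->.
  have := mmax (head c); rewrite ht => /(_ (eqxx _)); have := rho_out _ oc.
  by rewrite tc /=; lia.
move=> n; have := nneg n; have := ncut n; have := ntens n.
by rewrite !inE; case: (lab n) => //; auto.
Qed.

End Splitting.

(** The inner induction, on the arcs of the ground-structure. Restrictions reuse the boxes of [G]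
    unchanged, so the hypothesis on boxes, supplied by an outer structural induction, is carried
    along. *)
Lemma ACC_io_sequentializable_arcs k (G : ground)
    (b : forall n : node G, lab n == Bang -> pre_structure) :
  #|arc G| < k -> (forall m (hm : lab m == Bang), sequentializable (b m hm)) ->
  sequentializable (Pre b).
Proof.
elim: k G b => // k IH G b Gk IHb wf [inp polb] pol tm acc.
have IHarc (G' : ground) (b' : forall n : node G', lab n == Bang -> pre_structure) :
    #|arc G'| < #|arc G| -> (forall m (hm : lab m == Bang), sequentializable (b' m hm)) ->
    sequentializable (Pre b').
  by move=> lt; apply: IH; lia.
have [/existsP[n /andP[ln tn]]|/existsPn nu] := boolP [exists n : node G,
    (lab n \in [:: Bot; Par; Der; Why]) && terminalb n].
  apply: (unary_sequential wf pol tm acc IHb IHarc (n := n)); last exact/terminalP.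
  by move: ln; rewrite !inE => /or4P[] /eqP ->;
    [constructor 1 | constructor 2 | constructor 3 | constructor 4].
have no_unary (n : node G) : lab n \in [:: Bot; Par; Der; Why] -> ~~ terminalb n.
  by move=> ln; have := nu n; rewrite ln.
have polG : polarized_ground inp := pol.1; have tmG : par_out_terminal_ground inp := tm.1.
have [dacG _] := (ACC_io_groundE polG).1 acc.1.
have [/existsP[e0 fe0]|/existsPn nf] := boolP [exists e, fork inp e]; last first.
  apply: (alone_sequential wf pol tm acc IHb).
  exact: (no_fork_label polG tmG dacG no_unary nf).
have [rho rho_in rho_out] := io_rank tmG dacG no_unary.
have [e1 fe1 e1_min] := arg_minnP (fun e => rho (tail e)) fe0.
have /and3P[_ ln tn] := fe1.
have ln' : lab (head e1) = Cut \/ lab (head e1) = Tens.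
  by move: ln; rewrite !inE => /orP[] /eqP; [left | right].
exact: (binary_sequential wf pol tm acc IHb IHarc ln' (terminalP b _ tn)
  (ancestors_cut polG tmG dacG no_unary rho_in rho_out fe1 e1_min)
  (ancestors_balanced polG tmG dacG no_unary rho_in rho_out fe1 e1_min)).
Qed.

Lemma ACC_io_sequentializable (R : pre_structure) : sequentializable R.
Proof.
elim: R => G b IH; exact: (ACC_io_sequentializable_arcs (ltnSn _) IH).
Qed.

Theorem theorem21 (R : proof_structure) (pol : polarity R)
    (Rpol : polarized pol) (Rterm : par_out_terminal pol) :
  (ACC_w R <-> ACC_io pol) /\ (ACC_io pol <-> sequential R).
Proof.
have io_seq : ACC_io pol -> sequential R.
  by move: pol Rpol Rterm; case: R => R wf pol Rpol Rterm; apply: ACC_io_sequentializable.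
have w_io : ACC_w R -> ACC_io pol by apply: ACC_w_ACC_io.
split; split=> //; first by move/io_seq/sequential_ACC_w.
by move/sequential_ACC_w/w_io.
Qed.
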